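(* Let $(W,S)$ be a finitely generated Coxeter system with Cayley graph $\Lambda=\Lambda(W,S)$. For all real constants $\lambda>0$, $\epsilon\ge 0$ and every integer $B\ge 0$ there is an integer $K$, depending only on $\Lambda,\lambda,\epsilon,B$, such that the following holds: if $\alpha$ is a finite $(\lambda,\epsilon)$-quasi-geodesic edge path in $\Lambda$ from a vertex $a$ to a vertex $b$ with bracket number $B(\alpha)=B$, then there is a geodesic edge path $\beta$ in $\Lambda$ connecting $a$ and $b$ such that $\alpha$ is $K$-tracked by $\beta$.
   Context: A Coxeter system $(W,S)$ is a group $W$ with generating set $S$ and presentation $\langle S : (s_is_j)^{m(i,j)}\rangle$, where $m(i,j)=m(j,i)\in\{1,2,\ldots,\infty\}$, $m(i,j)=1$ iff $i=j$, and the relation is omitted if $m(i,j)=\infty$; it is finitely generated if $S$ is finite. The Cayley graph $\Lambda(W,S)$ has vertex set $W$ and, for each $w\in W$, $s\in S$, a single edge of length 1 labeled $s$ joining $w$ and $ws$; $d$ is the path metric, and $W$ acts on the left. A reflection is a conjugate in $W$ of an element of $S$. The wall $Q$ of a reflection is the set of edges of $\Lambda$ that are mapped to themselves (set-wise, with end vertices interchanged) by that reflection. Each edge belongs to exactly one wall. A finite edge path is a continuous map $\beta:[0,n]\to\Lambda$, $n$ a positive integer, mapping each $[k,k+1]$ ($k$ an integer) isometrically onto an edge; a ray is such a map on $[0,\infty)$ and a line is such a map on $(-\infty,\infty)$. An edge path is geodesic if $d(\beta(s),\beta(t))=|s-t|$ for all integers $s,t$ in its domain. It is a $(\lambda,\epsilon)$-quasi-geodesic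 if $|s-t|\le\lambda d(\beta(s),\beta(t))+\epsilon$ for all integers $s,t$ in its domain. For a vertex $t=\beta(k)$ of an edge path $\beta$, the bracket number $B(t,\beta)$ is the number of walls $Q$ such that $\beta$ has an edge of $Q$ on either side of $t$ (one at or before position $k$ and one at or after position $k$). The bracket number of $\beta$ is $B(\beta)=\max_t B(t,\beta)$ over all vertices $t$ of $\beta$. An edge path $\alpha$ is $K$-tracked by an edge path $\beta$ if each vertex of $\alpha$ is within distance $K$ of a vertex of $\beta$.
   Formalization: When a = b, the geodesic edge path β is allowed to be the constant path of length 0; with edge paths required to have positive length, no geodesic joins a to itself and the claim would fail for closed paths α. *)

(* Defs.v *)
From mathcomp Require Import all_boot all_order all_algebra finmap.
From mathcomp Require Import boolp classical_sets cardinality reals.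

Set Implicit Arguments.
Unset Strict Implicit.
Unset Printing Implicit Defensive.

Import Order.TTheory GRing.Theory Num.Theory.

Local Open Scope fset_scope.
Local Open Scope classical_set_scope.
Local Open Scope group_scope.

(* Words over the alphabet X and formal inverses: (x, false) stands for x and
   (x, true) for x^-1. *)
Definition word (X : Type) := seq (X * bool).

(* The quotient of the words by [pres_eq R] is the group with generators X and
   relators R, that is, the free group on X modulo the normal closure of R. *)
Inductive pres_eq (X : Type) (R : word X -> Prop) : word X -> word X -> Prop :=
| pres_refl u : pres_eq R u u
| pres_sym u v : pres_eq R u v -> pres_eq R v u
| pres_trans u v w : pres_eq R u v -> pres_eq R v w -> pres_eq R u w
| pres_cancel u v x b :
    pres_eq R (u ++ [:: (x, b); (x, ~~ b)] ++ v) (u ++ v)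
| pres_relator u v r : R r -> pres_eq R (u ++ r ++ v) (u ++ v).

Section Coxeter.
Variable W : groupType.
Implicit Types (S : {fset W}) (w x y r : W).

Definition word_val S (u : word S) : W :=
  foldr (fun l g => (if l.2 then (val l.1)^-1 else val l.1) * g) 1 u.

Definition presents S (R : word S -> Prop) : Prop :=
  (forall w, exists u : word S, word_val u = w) /\
  (forall u v : word S, word_val u = word_val v <-> pres_eq R u v).

(* [None] stands for infinity. *)
Definition coxeter_matrix S (m : S -> S -> option nat) : Prop :=
  [/\ forall s t, m s t = m t s,
      forall s t, m s t <> Some 0%N &
      forall s t, m s t = Some 1%N <-> s = t].

Definition coxeter_relator S (m : S -> S -> option nat) (u : word S) : Prop :=
  exists (s t : S) (k : nat),
    m s t = Some k /\ u = flatten (nseq k [:: (s, false); (t, false)]).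

Definition coxeter_system S : Prop :=
  exists m : S -> S -> option nat,
    coxeter_matrix m /\ presents (coxeter_relator m).

(* The vertices of the Cayley graph are the elements of W.  An edge is the set
   of its two ends, which determine its label. *)
Definition cayley_adj S x y : Prop := exists2 s, s \in S & y = x * s.

(* An edge path beta : [0, n] -> Lambda is given by its vertices
   beta 0, ..., beta n; the values beta k with k > n are irrelevant.
   The constant path n = 0 is allowed. *)
Definition edge_path S (n : nat) (beta : nat -> W) : Prop :=
  forall k, (k < n)%N -> cayley_adj S (beta k) (beta k.+1).

Definition joined S x y (n : nat) : Prop :=
  exists beta : nat -> W, [/\ edge_path S n beta, beta 0%N = x & beta n = y].

(* The path metric on vertices; the value 0 for vertices that no path joins
   never occurs when S generates W. *)
Definition dist S x y : nat :=
  if pselect (exists n, `[< joined S x y n >]) is left ex then ex_minn ex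
  else 0%N.

Definition reflection S r : Prop :=
  exists w s, s \in S /\ r = w * s * w^-1.

Definition wall S r : set {fset W} :=
  [set e | exists x y,
    [/\ cayley_adj S x y, e = [fset x; y], r * x = y & r * y = x]].

Definition is_wall S (Q : set {fset W}) : Prop :=
  exists2 r, reflection S r & Q = wall S r.

Definition path_edge (beta : nat -> W) (k : nat) : {fset W} :=
  [fset beta k; beta k.+1].

Definition bracketing_walls S (n : nat) (beta : nat -> W) (k : nat) :
    set (set {fset W}) :=
  [set Q | is_wall S Q /\
    exists i j, [/\ (i < k)%N, (k <= j)%N, (j < n)%N,
                    Q (path_edge beta i) & Q (path_edge beta j)]].

(* [fset_set] sends infinite sets to the empty set, but this set is always
   finite: a path has finitely many edges and each edge lies in one wall. *)
Definition bracket_number_at S n beta k : nat :=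
  #|` fset_set (bracketing_walls S n beta k) |.

Definition bracket_number S n beta : nat :=
  \max_(k < n.+1) bracket_number_at S n beta k.

Local Open Scope ring_scope.

Definition geodesic S (n : nat) (beta : nat -> W) : Prop :=
  forall s t, (s <= n)%N -> (t <= n)%N ->
    (dist S (beta s) (beta t))%:Z = `|s%:Z - t%:Z|.

Definition quasi_geodesic (R : realType) (lambda epsilon : R)
    S (n : nat) (beta : nat -> W) : Prop :=
  forall s t, (s <= n)%N -> (t <= n)%N ->
    `|s%:R - t%:R| <= lambda * (dist S (beta s) (beta t))%:R + epsilon.

Definition tracked S (K n : nat) (alpha : nat -> W) (l : nat) (beta : nat -> W)
    : Prop :=
  forall i, (i <= n)%N ->
    exists2 j, (j <= l)%N & (dist S (alpha i) (beta j) <= K)%N.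

End Coxeter.

(* Main.v *)
(** Walls correspond to the roots [act x alpha_s] of the geometric representation, up to sign, and a wall
    separates [x] from [y] when its root changes sign between [x^-1] and [y^-1].  Walk along the path
    [eta] and keep points [p j], one for each vertex [eta j] passed so far, on a geodesic from [eta 0] to the
    current vertex [t].  A step from [t] to [t s] away from [eta 0] extends the geodesic; after a step
    towards [eta 0] replace, in the weak order based at [t], each [p j] by its join with [t s], which lies
    on a geodesic from [t s] to [eta 0].  The point [p j] moves only if the wall of the step separates
    [p j] from [eta 0]; it then also separates [eta j] from [eta 0], so it brackets [eta j], and it never
    moves [p j] again.  So [p j] moves at most [B] times.  Each move has bounded length: the quotient of
    the join of [p] and [s] by [p] depends only on the small root [p^-1 alpha_s] and on the small roots
    that [p] makes negative, and by Brink and Howlett there are finitely many small roots. *)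

Require Import Defs.
From mathcomp Require Import all_boot all_order all_algebra finmap.
From mathcomp Require Import boolp classical_sets cardinality reals.
From mathcomp Require Import trigo.
From mathcomp Require Import ring lra zify.

Import Order.TTheory GRing.Theory Num.Theory.
Local Open Scope ring_scope.

(** Neither the number of moves of a point nor the length of a move may depend on the path. Behind
    the count is an invariant: every wall between [eta 0] and [p j] also lies between [eta 0] and
    [eta j], and a move only removes walls from the first set. The length is the harder matter,
    since in an infinite group the join of [p] with a generator has no evident bound. Finiteness of
    the small roots rests on three facts: distinct small roots satisfy [B g h < 1], because a value
    of at least 1 forces dominance; on roots the form takes only finitely many values strictly
    between -1 and 1; and a chain of small roots of increasing height cannot repeat its values
    [bf g s]. On the side of the weak order everything comes from the link between length and signs
    of roots: it yields the dihedral prefixes behind the joins and the inversion criterion for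
    geodesics. *)

Section CoxeterSystem.
Set Implicit Arguments.
Unset Strict Implicit.
Variables (W : groupType) (S : {fset W}) (m : S -> S -> option nat).
Hypotheses (hm : coxeter_matrix m) (hp : presents (coxeter_relator m)).
Variable R : realType.

(** * The universal property of the presentation *)

(** Used with [bool] for the parity of the length and with [V] for the geometric representation. An
    element acts through a chosen word; cancellations and relators act trivially, so the choice does
    not matter. *)
Lemma presentation_action (X : Type) (f : S -> X -> X) :
  (forall s x, f s (f s x) = x) ->
  (forall s t k, m s t = Some k -> forall x, iter k (fun y => f s (f t y)) x = x) ->
  exists F : W -> X -> X,
    [/\ forall x, F 1%g x = x, forall v w x, F (v * w)%g x = F v (F w x) &
        forall s x, F (val s) x = f s x].
Proof.
move=> f2 fm.
pose act (u : word S) x := foldr (fun l y => f l.1 y) x u.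
have act_cat u v x : act (u ++ v) x = act u (act v x) by rewrite /act foldr_cat.
have act_eq u v : pres_eq (coxeter_relator m) u v -> forall x, act u x = act v x.
  elim=> {u v} //.
  - by move=> u v w _ e1 _ e2 x; rewrite e1 e2.
  - by move=> u v s b x; rewrite !act_cat /= f2.
  - move=> u v r [s [t [k [hk ->]]]] x; rewrite !act_cat; congr act.
    rewrite -[RHS](fm _ _ _ hk); elim: (k) => //= j IH; by rewrite IH.
case: hp => gen pres.
pose wd w := sval (cid (gen w)).
have wdK w : word_val (wd w) = w by rewrite /wd; case: cid.
have F_word u x : act (wd (word_val u)) x = act u x.
  by apply: act_eq; apply/pres; rewrite wdK.
exists (fun w => act (wd w)); split.
- by move=> x; rewrite (F_word [::]).
- move=> v w x; rewrite -act_cat.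
  suff -> : (v * w)%g = word_val (wd v ++ wd w) by rewrite F_word.
  rewrite -{1}[v]wdK -{1}[w]wdK; elim: (wd v) => [|l u IH] /=; first by rewrite mul1g.
  by rewrite -mulgA IH.
- move=> s x; rewrite -[RHS]/(act [:: (s, false)] x).
  suff -> : val s = word_val [:: (s, false)] by rewrite F_word.
  by rewrite /= mulg1.
Qed.

Lemma gensq (s : S) : (val s * val s = 1)%g.
Proof.
case: hp => _ pres; case: hm => _ _ m1.
have := (pres [:: (s, false); (s, false)] [::]).2.
rewrite /= mulg1; apply.
have := @pres_relator _ (coxeter_relator m) [::] [::] [:: (s, false); (s, false)].
by apply; exists s, s, 1%N; split => //; apply/m1.
Qed.

Lemma genV (s : S) : (val s)^-1%g = val s.
Proof. by apply/mulg1_eq/gensq. Qed.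

Lemma genK (s : S) (w : W) : (val s * (val s * w) = w)%g.
Proof. by rewrite mulgA gensq mul1g. Qed.

Lemma genKr (s : S) (w : W) : (w * val s * val s = w)%g.
Proof. by rewrite -mulgA gensq mulg1. Qed.

Definition wprod (u : seq S) : W := foldr (fun s g => (val s * g)%g) 1%g u.

Lemma wprod_cons s u : wprod (s :: u) = (val s * wprod u)%g.
Proof. by []. Qed.

Lemma wprod_cat u v : wprod (u ++ v) = (wprod u * wprod v)%g.
Proof. by elim: u => [|s u IH] /=; rewrite ?mul1g // IH mulgA. Qed.

Lemma wprod_rev u : wprod (rev u) = (wprod u)^-1%g.
Proof.
elim: u => [|s u IH]; first by rewrite invg1.
by rewrite rev_cons -cats1 wprod_cat IH /= mulg1 invgM genV.
Qed.

Lemma wprod_gen w : exists u, wprod u = w.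
Proof.
case: hp => gen _; case: (gen w) => u <-; exists (map fst u).
by elim: u => [//|[s b] u IH] /=; rewrite IH; case: b; rewrite ?genV.
Qed.

Lemma gen_relation s t k : m s t = Some k ->
  wprod (flatten (nseq k [:: s; t])) = 1%g.
Proof.
move=> hk; case: hp => _ pres.
have := (pres (flatten (nseq k [:: (s, false); (t, false)])) [::]).2.
have -> : word_val (flatten (nseq k [:: (s, false); (t, false)])) =
          wprod (flatten (nseq k [:: s; t])).
  by elim: k {hk} => //= k <-.
apply; have := @pres_relator _ (coxeter_relator m) [::] [::] _.
by rewrite /= => /(_ (flatten (nseq k [:: (s, false); (t, false)]))); rewrite cats0; apply; exists s, t, k.
Qed.

(** * Length *)

Definition len (w : W) : nat :=
  ex_minn (let: ex_intro u e := wprod_gen w in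
    ex_intro (fun n => `[< exists2 u, wprod u = w & size u = n >]) (size u)
      (asboolT (ex_intro2 _ _ u e erefl))).

Lemma reduced_word w : exists2 u, wprod u = w & size u = len w.
Proof. by rewrite /len; case: ex_minnP => n /asboolP. Qed.

Lemma len_le u : (len (wprod u) <= size u)%N.
Proof.
rewrite /len; case: ex_minnP => n _; apply.
by apply/asboolP; exists u.
Qed.

Lemma len1 : len 1%g = 0%N.
Proof. by apply/eqP; rewrite -leqn0; apply: (len_le [::]). Qed.

Lemma len_eq0 w : (len w == 0%N) = (w == 1%g).
Proof.
apply/eqP/eqP => [|->]; last exact: len1.
by case: (reduced_word w) => u <- <- /eqP/nilP ->.
Qed.

Lemma lenM v w : (len (v * w)%g <= len v + len w)%N.
Proof.
case: (reduced_word v) => u <- <-; case: (reduced_word w) => u' <- <-.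
by rewrite -wprod_cat -size_cat len_le.
Qed.

Lemma lenV w : len w^-1%g = len w.
Proof.
have h v : (len v^-1%g <= len v)%N.
  by case: (reduced_word v) => u <- <-; rewrite -wprod_rev -(size_rev u) len_le.
by apply/eqP; rewrite eqn_leq h -{1}[w]invgK h.
Qed.

(** All relators have even length, so letting every letter negate a Boolean is an action. Its
    purpose is that multiplication by a generator always changes the length. *)
Lemma len_parity : exists par : W -> bool,
  [/\ forall v w, par (v * w)%g = par v (+) par w, forall s : S, par (val s) &
      forall w, odd (len w) = par w].
Proof.
case: (@presentation_action bool (fun _ => negb)) => [s x|s t k _|F [F1 FM Fs]].
- exact: negbK.
- by elim: k => //= k IH [|] /=; rewrite IH.
have Fw u b : F (wprod u) b = odd (size u) (+) b.
  by elim: u b => [|s u IH] b /=; rewrite ?F1 // FM Fs IH addNb.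
have FE w b : F w b = F w false (+) b.
  by case: (reduced_word w) => u <- _; rewrite !Fw addbF.
exists (fun w => F w false); split=> [v w|s|w]; first by rewrite FM FE.
  by rewrite Fs.
by case: (reduced_word w) => u <- <-; rewrite Fw addbF.
Qed.

Lemma len_gen (s : S) : len (val s) = 1%N.
Proof.
have : (len (val s) <= 1)%N by have := len_le [:: s]; rewrite /= mulg1.
case: len_parity => par [_ par1 parE].
by have := parE (val s); rewrite par1; case: (len _) => [|[]].
Qed.

Lemma len_mull_neq (s : S) w : len (val s * w)%g != len w.
Proof.
case: len_parity => par [parM par1 parE]; apply/negP => /eqP e.
by have := parE (val s * w)%g; rewrite e parM parE par1; case: (par w).
Qed.

Lemma len_mull (s : S) w :
  len (val s * w)%g = (len w).+1 \/ len w = (len (val s * w)%g).+1.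
Proof.
have := lenM (val s) w; have := lenM (val s) (val s * w)%g.
have := len_mull_neq s w; rewrite genK len_gen; move: (len _) (len _) => a b.
by rewrite neq_ltn => /orP[] *; [right|left]; lia.
Qed.

Lemma len_mulr w (s : S) :
  len (w * val s)%g = (len w).+1 \/ len w = (len (w * val s)%g).+1.
Proof.
have := len_mull s w^-1%g; have -> : (val s * w^-1)%g = (w * val s)^-1%g.
  by rewrite invgM genV.
by rewrite !lenV.
Qed.

Lemma len_left_descent w : w <> 1%g -> exists s : S, len w = (len (val s * w)%g).+1.
Proof.
case: (reduced_word w) => -[|s u] <- //= e _; exists s.
case: (len_mull s (val s * wprod u)%g) => //; rewrite genK -e.
by have := len_le u; lia.
Qed.

(** * Alternating words and the weak order *)

Fixpoint alt (s t : S) (k : nat) : seq S := if k is k'.+1 then s :: alt t s k' else [::].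

Lemma size_alt s t k : size (alt s t k) = k.
Proof. by elim: k s t => //= k IH s t; rewrite IH. Qed.

Lemma altS s t k : alt s t k.+1 = s :: alt t s k.
Proof. by []. Qed.

Lemma altD s t j k :
  alt s t (j + k) = alt s t j ++ (if odd j then alt t s k else alt s t k).
Proof. by elim: j s t => //= j IH s t; rewrite IH; case: (odd j). Qed.

Lemma alt_rev s t k : rev (alt s t k) = if odd k then alt s t k else alt t s k.
Proof.
elim: k s t => //= k IH s t; rewrite rev_cons IH.
have h p q : rcons (alt p q k) (if odd k then q else p) = alt p q k.+1.
  elim: k p q {IH} => //= k IH p q; congr cons.
  by rewrite -[RHS](IH q p); case: (odd k).
by have := h t s; have := h s t; case: (odd k) => /= [_ <-|<- _].
Qed.

Lemma alt_double s t k : flatten (nseq k [:: s; t]) = alt s t (k + k).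
Proof. by elim: k => //= k IH; rewrite addnS /= IH. Qed.

Lemma alt_braid s t k : m s t = Some k -> wprod (alt s t k) = wprod (alt t s k).
Proof.
move=> /gen_relation; rewrite alt_double altD wprod_cat => /mulg1_eq.
rewrite -wprod_rev alt_rev; by case: (odd k) => ->.
Qed.

(** The right weak order: [x] lies on a geodesic from 1 to [y]. *)
Definition wle (x y : W) : bool := len y == (len x + len (x^-1 * y)%g)%N.

Lemma wle_refl x : wle x x.
Proof. by rewrite /wle mulVg len1 addn0. Qed.

Lemma wle1 x : wle 1%g x.
Proof. by rewrite /wle invg1 mul1g len1. Qed.

Lemma wleE p w : wle p (p * w)%g = (len (p * w)%g == (len p + len w)%N).
Proof. by rewrite /wle mulKg. Qed.

Lemma len_triangle x y z : (len (x^-1 * z)%g <= len (x^-1 * y)%g + len (y^-1 * z)%g)%N.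
Proof. by have := lenM (x^-1 * y)%g (y^-1 * z)%g; rewrite mulgA mulgK. Qed.

Lemma wle_triangle x z : (len z <= len x + len (x^-1 * z)%g)%N.
Proof. by have := lenM x (x^-1 * z)%g; rewrite mulVKg. Qed.

Lemma wle_between x y z : wle x y -> wle y z ->
  len (x^-1 * z)%g = (len (x^-1 * y)%g + len (y^-1 * z)%g)%N.
Proof.
move=> /eqP xy /eqP yz; have := len_triangle x y z; have := wle_triangle x z.
lia.
Qed.

Lemma wle_trans y x z : wle x y -> wle y z -> wle x z.
Proof.
move=> xy yz; have e := wle_between xy yz; move/eqP: xy; move/eqP: yz.
rewrite /wle e => -> ->; by rewrite addnA.
Qed.

Lemma wle_len x y : wle x y -> (len x <= len y)%N.
Proof. by move/eqP ->; rewrite leq_addr. Qed.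

Lemma wle_len_eq x y : wle x y -> (len y <= len x)%N -> x = y.
Proof.
move=> /eqP -> h; have /eqP : len (x^-1 * y)%g = 0%N by lia.
by rewrite len_eq0 => /eqP e; rewrite -(mulVKg x y) e mulg1.
Qed.

Lemma wle_cancel p x y : wle p x -> wle p y -> wle x y = wle (p^-1 * x)%g (p^-1 * y)%g.
Proof.
move=> /eqP px /eqP py; rewrite /wle px py invgM invgK -mulgA mulVKg.
by rewrite -addnA eqn_add2l.
Qed.

Lemma wle_gen (s : S) w : wle (val s) w = (len (val s * w)%g < len w)%N.
Proof.
rewrite /wle genV len_gen add1n; case: (len_mull s w) => ->.
  by rewrite ltnNge leqnSn ltn_eqF.
by rewrite eqxx ltnSn.
Qed.

Lemma wle_genr w (s : S) : wle w (w * val s)%g = (len w < len (w * val s)%g)%N.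
Proof.
rewrite wleE len_gen addn1; case: (len_mulr w s) => ->.
  by rewrite eqxx ltnSn.
by rewrite ltnNge leqnSn ltn_eqF.
Qed.

(** * The geometric representation *)

Notation V := {ffun S -> R^o}.

(** The Tits form on the simple roots; -1 is the limit of its values as the label grows. *)
Definition gram (s t : S) : R :=
  if m s t is Some n then - cos (pi / n%:R) else -1.

Definition coord (v : V) (q : S) : R := v q.

Lemma coordD u v q : coord (u + v) q = coord u q + coord v q.
Proof. by rewrite /coord ffunE. Qed.

Lemma coordZ a v q : coord (a *: v) q = a * coord v q.
Proof. by rewrite /coord ffunE. Qed.

Lemma coordN v q : coord (- v) q = - coord v q.
Proof. by rewrite /coord ffunE. Qed.

Lemma coord0 q : coord 0 q = 0.
Proof. by rewrite /coord ffunE. Qed.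

Lemma coordP u v : (forall q, coord u q = coord v q) -> u = v.
Proof. by move=> e; apply/ffunP. Qed.

Definition bf (v : V) (s : S) : R := \sum_q coord v q * gram q s.

Definition B (u v : V) : R := \sum_s coord u s * bf v s.

Definition alpha (s : S) : V := [ffun q => (q == s)%:R].

Lemma coord_alpha s q : coord (alpha s) q = (q == s)%:R.
Proof. by rewrite /coord ffunE. Qed.

Definition coordE := (coordD, coordZ, coordN, coord0, coord_alpha).

Definition srefl (s : S) (v : V) : V := v - (2 * bf v s) *: alpha s.

Lemma gramC s t : gram s t = gram t s.
Proof. by case: hm => mC _ _; rewrite /gram mC. Qed.

Lemma m_diag s : m s s = Some 1%N.
Proof. by case: hm => _ _ m1; apply/m1. Qed.

Lemma m_offdiag s t k : s <> t -> m s t = Some k -> (1 < k)%N.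
Proof.
case: hm => _ m0 m1 st; case: k => [/m0 //|[/m1 //|]].
by [].
Qed.

Lemma gram_diag s : gram s s = 1.
Proof. by rewrite /gram m_diag divr1 cospi opprK. Qed.

Lemma bfD u v s : bf (u + v) s = bf u s + bf v s.
Proof. by rewrite /bf -big_split; apply: eq_bigr => q _; rewrite coordE mulrDl. Qed.

Lemma bfZ a v s : bf (a *: v) s = a * bf v s.
Proof. by rewrite /bf mulr_sumr; apply: eq_bigr => q _; rewrite coordE -mulrA. Qed.

Lemma bfN v s : bf (- v) s = - bf v s.
Proof. by rewrite -scaleN1r bfZ mulN1r. Qed.

Lemma bf_alpha q s : bf (alpha q) s = gram q s.
Proof.
rewrite /bf (bigD1 q) //= coordE eqxx mul1r big1 ?addr0 // => t tq.
by rewrite coordE (negbTE tq) mul0r.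
Qed.

Lemma BC u v : B u v = B v u.
Proof.
rewrite /B /bf; under eq_bigr => s _ do rewrite mulr_sumr.
rewrite exchange_big; apply: eq_bigr => q _; rewrite mulr_sumr.
by apply: eq_bigr => s _; rewrite gramC; ring.
Qed.

Lemma BDr u v w : B u (v + w) = B u v + B u w.
Proof. by rewrite /B -big_split; apply: eq_bigr => s _; rewrite bfD mulrDr. Qed.

Lemma BZr a u v : B u (a *: v) = a * B u v.
Proof. by rewrite /B mulr_sumr; apply: eq_bigr => s _; rewrite bfZ; ring. Qed.

Lemma BNr u v : B u (- v) = - B u v.
Proof. by rewrite -scaleN1r BZr mulN1r. Qed.

Lemma BDl u v w : B (u + v) w = B u w + B v w.
Proof. by rewrite BC BDr !(BC w). Qed.

Lemma BZl a u v : B (a *: u) v = a * B u v.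
Proof. by rewrite BC BZr BC. Qed.

Lemma BNl u v : B (- u) v = - B u v.
Proof. by rewrite BC BNr BC. Qed.

Lemma B_alphal s v : B (alpha s) v = bf v s.
Proof.
rewrite /B (bigD1 s) //= coordE eqxx mul1r big1 ?addr0 // => t ts.
by rewrite coordE (negbTE ts) mul0r.
Qed.

Lemma B_alphar v s : B v (alpha s) = bf v s.
Proof. by rewrite BC B_alphal. Qed.

Definition BE := (BDr, BDl, BZr, BZl, BNr, BNl, B_alphal, B_alphar, bf_alpha, gram_diag, bfD, bfZ, bfN).

Lemma sreflD s u v : srefl s (u + v) = srefl s u + srefl s v.
Proof. by rewrite /srefl bfD mulrDr scalerDl opprD addrACA. Qed.

Lemma sreflZ s a v : srefl s (a *: v) = a *: srefl s v.
Proof. by rewrite /srefl bfZ scalerBr scalerA mulrCA. Qed.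

Lemma sreflK s v : srefl s (srefl s v) = v.
Proof.
by rewrite /srefl !BE; apply: coordP => q; rewrite !coordE; ring.
Qed.

Lemma B_srefl s u v : B (srefl s u) (srefl s v) = B u v.
Proof. by rewrite /srefl !BE; ring. Qed.

(** Chebyshev polynomials of the second kind, shifted by one: at [c = cos x] the value is
    [sin (n x) / sin x]. They are the coordinates of the roots of a dihedral subgroup. *)
Fixpoint cheb (c : R) (n : nat) : R :=
  if n is n'.+1 then if n' is n''.+1 then 2 * c * cheb c n' - cheb c n'' else 1 else 0.

Lemma chebSS c n : cheb c n.+2 = 2 * c * cheb c n.+1 - cheb c n.
Proof. by []. Qed.

Lemma cheb_sin x n : sin x * cheb (cos x) n = sin (n%:R * x).
Proof.
suff: sin x * cheb (cos x) n = sin (n%:R * x) /\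
      sin x * cheb (cos x) n.+1 = sin (n.+1%:R * x) by case.
elim: n => [|n [IH1 IH2]]; first by rewrite /= mul0r sin0 mulr0 mul1r mulr1.
split=> //; rewrite chebSS mulrBr IH1.
have -> : sin x * (2 * cos x * cheb (cos x) n.+1) = 2 * cos x * sin (n.+1%:R * x).
  by rewrite -IH2; ring.
have -> : n.+2%:R * x = n.+1%:R * x + x by rewrite -[n.+2%:R]natr1; ring.
have -> : n%:R * x = n.+1%:R * x - x by rewrite -[n.+1%:R]natr1; ring.
by rewrite sinB sinD; ring.
Qed.

Definition le_order (n : nat) (s t : S) : bool :=
  if m s t is Some k then (n <= k)%N else true.

Lemma le_orderW n s t : le_order n.+1 s t -> le_order n s t.
Proof. by rewrite /le_order; case: (m s t) => // k /ltnW. Qed.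

(** For a label [k] the value is [sin (n pi / k) / sin (pi / k)], and [n <= k] keeps the angle
    within half a turn. For an infinite label it is [n]. *)
Lemma cheb_ge0 s t n : s <> t -> le_order n s t -> 0 <= cheb (- gram s t) n.
Proof.
rewrite /le_order => st; rewrite /gram; case E: (m s t) => [k|] hn; rewrite opprK; last first.
  suff -> : cheb 1 n = n%:R by [].
  suff: cheb 1 n = n%:R /\ cheb 1 n.+1 = n.+1%:R by case.
  elim: {hn} n => [//|n [IH1 IH2]]; split=> //.
  by rewrite chebSS IH1 IH2 -[n.+2%:R]natr1 -[n.+1%:R]natr1; ring.
have k1 := m_offdiag st E; have k0 : 0 < k%:R :> R by rewrite ltr0n; lia.
have pi0 := @pi_gt0 R.
have sx : 0 < sin (pi / k%:R : R).
  apply: sin_gt0_pi; rewrite divr_gt0 //= ltr_pdivrMr // ltr_pMr // ltr1n.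
  exact: k1.
rewrite -(pmulr_rge0 _ sx) cheb_sin; apply: sin_ge0_pi; apply/andP; split.
  by rewrite mulr_ge0 // divr_ge0 // ltW.
by rewrite mulrCA ger_pMr // ler_pdivrMr // mul1r ler_nat.
Qed.

Lemma srefl_comb s t x y : srefl s (x *: alpha s + y *: alpha t) =
  (2 * (- gram s t) * y - x) *: alpha s + y *: alpha t.
Proof.
rewrite /srefl !BE (gramC t); apply: coordP => q; rewrite !coordE; ring.
Qed.

(** On the plane of [alpha s] and [alpha t] the product of the two reflections is a rotation by
    [2 pi / k], whose powers are given by [cheb]; on the orthogonal complement it is the
    identity. *)
Lemma srefl_braid s t k : m s t = Some k ->
  forall v, iter k (fun u => srefl s (srefl t u)) v = v.
Proof.
case: (eqVneq s t) => [<-|/eqP st] E.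
  by move: E; rewrite m_diag => -[<-] v /=; rewrite sreflK.
set c := - gram s t; pose f u := srefl s (srefl t u).
have fD u v : f (u + v) = f u + f v by rewrite /f !sreflD.
have fZ a v : f (a *: v) = a *: f v by rewrite /f !sreflZ.
have ifD n u v : iter n f (u + v) = iter n f u + iter n f v.
  by elim: n => //= n ->; rewrite fD.
have ifZ n a v : iter n f (a *: v) = a *: iter n f v.
  by elim: n => //= n ->; rewrite fZ.
have f_comb x y : f (x *: alpha s + y *: alpha t) =
    (2 * c * (2 * c * x - y) - x) *: alpha s + (2 * c * x - y) *: alpha t.
  by rewrite /f addrC srefl_comb addrC srefl_comb (gramC t).
have fs n : iter n f (alpha s) = cheb c n.*2.+1 *: alpha s + cheb c n.*2 *: alpha t.
  elim: n => [|n IH]; first by rewrite /= scale1r scale0r addr0.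
  by rewrite iterS IH f_comb doubleS.
have ft n : iter n.+1 f (alpha t) = - cheb c n.*2.+2 *: alpha s - cheb c n.*2.+1 *: alpha t.
  elim: n => [|n IH].
    rewrite /= -[alpha t]add0r -{1}(scale0r (alpha s)) -{1}(scale1r (alpha t)) f_comb.
    by rewrite add0r -scaleNr; congr (_ *: _ + _ *: _); ring.
  rewrite iterS IH -scaleNr f_comb -scaleNr doubleS !chebSS; congr (_ *: _ + _ *: _); ring.
have k1 := m_offdiag st E; have k0 : 0 < k%:R :> R by rewrite ltr0n; lia.
have pi0 := @pi_gt0 R; set x : R := pi / k%:R.
have cE : c = cos x by rewrite /c /gram E opprK.
have sx : 0 < sin x.
  apply: sin_gt0_pi; rewrite divr_gt0 //= ltr_pdivrMr // ltr_pMr // ltr1n.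
  exact: k1.
have sx0 : sin x != 0 by rewrite gt_eqF.
have kx : k.*2%:R * x = pi *+ 2.
  by rewrite -muln2 natrM /x; field; rewrite gt_eqF.
have c0 : cheb c k.*2 = 0.
  by apply: (mulfI sx0); rewrite cE cheb_sin kx sin2pi mulr0.
have c1 : cheb c k.*2.+1 = 1.
  apply: (mulfI sx0); rewrite cE cheb_sin -natr1 mulrDl mul1r kx addrC.
  by rewrite mulr1 (sinD2pi x).
have ks : iter k f (alpha s) = alpha s by rewrite fs c0 c1 scale1r scale0r addr0.
have kt : iter k f (alpha t) = alpha t.
  case: (k) k1 c0 c1 => [//|j] _ c0 c1; rewrite ft.
  move: c1; rewrite doubleS in c0 *; rewrite chebSS c0 mulr0 add0r => c1.
  by rewrite oppr0 scale0r add0r -scaleNr c1 scale1r.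
move=> v; set g := gram s t; have g1 : 1 - g * g != 0.
  have -> : 1 - g * g = sin x ^+ 2.
    have -> : g = - c by rewrite /c opprK.
    by rewrite sin2cos2 cE; ring.
  by rewrite expf_neq0.
set a := bf v s; set b := bf v t.
(* The orthogonal projection of [v] to the plane; it exists because [1 - g * g] is a nonzero squared
   sine. *)
pose p := ((a - g * b) / (1 - g * g)) *: alpha s + ((b - g * a) / (1 - g * g)) *: alpha t.
have -> : v = (v - p) + p by rewrite subrK.
have fq : f (v - p) = v - p.
  have qs : bf (v - p) s = 0.
    by rewrite /p !BE (gramC t) -/a -/g; field.
  have qt : bf (v - p) t = 0.
    by rewrite /p !BE -/b -/g; field.
  by rewrite /f /srefl qt mulr0 scale0r subr0 qs mulr0 scale0r subr0.
rewrite -/f ifD; congr (_ + _); first by elim: (k) => //= n ->.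
by rewrite /p ifD !ifZ ks kt.
Qed.

Definition act : W -> V -> V :=
  sval (cid (presentation_action sreflK srefl_braid)).

Lemma act1 v : act 1%g v = v.
Proof. by rewrite /act; case: cid => F [] /=. Qed.

Lemma actM x y v : act (x * y)%g v = act x (act y v).
Proof. by rewrite /act; case: cid => F [] /=. Qed.

Lemma act_gen (s : S) v : act (val s) v = srefl s v.
Proof. by rewrite /act; case: cid => F [] /=. Qed.

Lemma actK x v : act x^-1%g (act x v) = v.
Proof. by rewrite -actM mulVg act1. Qed.

Lemma actVK x v : act x (act x^-1%g v) = v.
Proof. by rewrite -actM mulgV act1. Qed.

Lemma actD x u v : act x (u + v) = act x u + act x v.
Proof.
case: (reduced_word x) => w <- _; elim: w => [|s w IH] /=; first by rewrite !act1.
by rewrite !actM IH !act_gen sreflD.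
Qed.

Lemma actZ x a v : act x (a *: v) = a *: act x v.
Proof.
case: (reduced_word x) => w <- _; elim: w => [|s w IH] /=; first by rewrite !act1.
by rewrite !actM IH !act_gen sreflZ.
Qed.

Lemma actN x v : act x (- v) = - act x v.
Proof. by rewrite -scaleN1r actZ scaleN1r. Qed.

Lemma B_act x u v : B (act x u) (act x v) = B u v.
Proof.
case: (reduced_word x) => w <- _; elim: w => [|s w IH] /=; first by rewrite !act1.
by rewrite !actM !act_gen B_srefl.
Qed.

Lemma act_gen_alpha (s : S) : act (val s) (alpha s) = - alpha s.
Proof. by rewrite act_gen /srefl !BE mulr1 scaler_nat mulr2n opprD addNKr. Qed.

(** * Signs of roots and descents *)

Definition pos (v : V) : bool := [forall q, 0 <= coord v q].

Lemma posP v : reflect (forall q, 0 <= coord v q) (pos v).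
Proof. exact: forallP. Qed.

Lemma posD u v : pos u -> pos v -> pos (u + v).
Proof. by move=> /posP u0 /posP v0; apply/posP => q; rewrite coordE addr_ge0. Qed.

Lemma posZ a v : 0 <= a -> pos v -> pos (a *: v).
Proof. by move=> a0 /posP v0; apply/posP => q; rewrite coordE mulr_ge0. Qed.

Lemma pos_alpha s : pos (alpha s).
Proof. by apply/posP => q; rewrite coordE ler0n. Qed.

Lemma pos_antisym v : pos v -> pos (- v) -> v = 0.
Proof.
move=> /posP v0 /posP v1; apply: coordP => q; apply/eqP.
by rewrite coordE eq_le v0 andbT -oppr_ge0 -coordN v1.
Qed.

Definition root (v : V) : Prop := exists w s, v = act w (alpha s).

Lemma root_alpha s : root (alpha s).
Proof. by exists 1%g, s; rewrite act1. Qed.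

Lemma root_act w v : root v -> root (act w v).
Proof. by case=> x [s ->]; exists (w * x)%g, s; rewrite actM. Qed.

Lemma B_root v : root v -> B v v = 1.
Proof. by case=> w [s ->]; rewrite B_act !BE. Qed.

Lemma root_neq0 v : root v -> v <> 0.
Proof. by move=> /B_root h v0; move: h; rewrite v0 -(scale0r 0) BZl mul0r; lra. Qed.

Lemma rootN v : root v -> root (- v).
Proof.
by case=> w [s ->]; exists (w * val s)%g, s; rewrite actM act_gen_alpha actN.
Qed.

(** The index [j] serves the induction; at [j = 0] the vector acted on is [alpha s]. Which of [p],
    [q] is [s] depends on a parity that is irrelevant for positivity. *)
Lemma alt_act s t k j : exists p q, [/\ (p, q) = (s, t) \/ (p, q) = (t, s) &
  act (wprod (alt t s k))^-1%g
    (cheb (- gram s t) j.+1 *: alpha s + cheb (- gram s t) j *: alpha t) =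
  cheb (- gram s t) (j + k).+1 *: alpha p + cheb (- gram s t) (j + k) *: alpha q].
Proof.
elim: k s t j => [|k IH] s t j.
  by exists s, t; split; [left|rewrite /= invg1 act1 addn0].
case: (IH t s j.+1) => p [q [pq e]]; exists p, q; split; first by case: pq; auto.
rewrite /= invgM genV actM act_gen [_ *: alpha s + _]addrC srefl_comb (gramC t s) in e *.
by rewrite -chebSS e addnS.
Qed.

(** Take [k] maximal. The next letter of the alternation cannot shorten [v], by maximality; the last
    letter used cannot either, since it would cancel and make [w] too short. *)
Lemma max_alt_prefix (s t : S) w : (len (val t * w)%g < len w)%N ->
  exists k v, [/\ w = (wprod (alt t s k) * v)%g, len w = (k + len v)%N,
    (len v < len (val s * v)%g)%N & (len v < len (val t * v)%g)%N].
Proof.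
move=> tw.
pose P k := `[< exists v, w = (wprod (alt t s k) * v)%g /\ len w = (k + len v)%N >].
have P0 : exists k, P k.
  by exists 0%N; apply/asboolP; exists w; rewrite /= mul1g.
have Pmax k : P k -> (k <= len w)%N by move=> /asboolP[v [_ ->]]; rewrite leq_addr.
case: (ex_maxnP P0 Pmax) => k /asboolP[v [wE wl]] kmax.
exists k, v.
have snoc j : wprod (alt t s j.+1) =
    (wprod (alt t s j) * val (if odd j then s else t))%g.
  by rewrite -addn1 altD wprod_cat; case: (odd j); rewrite /= mulg1.
have next : (len v < len (val (if odd k then s else t) * v)%g)%N.
  case: (len_mull (if odd k then s else t) v) => [->|h]; first exact: ltnSn.
  suff /kmax : P k.+1 by rewrite ltnn.
  apply/asboolP; exists (val (if odd k then s else t) * v)%g.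
  by rewrite snoc -mulgA genK addSnnS -h.
have prev : (len v < len (val (if odd k then t else s) * v)%g)%N.
  case: k kmax wE wl {next} => [|k] kmax wE wl /=; last first.
    have := lenM (wprod (alt t s k)) (val (if odd k then s else t) * v)%g.
    rewrite mulgA -snoc -wE wl.
    have := len_le (alt t s k); rewrite size_alt => h1 h2; have := leq_trans h2 (leq_add h1 (leqnn _)).
    by rewrite addSn -addnS leq_add2l; case: (odd k).
  suff /kmax : P 1%N by [].
  apply/asboolP; exists (val t * w)%g; rewrite /= mulg1 genK.
  by case: (len_mull t w) => e //; move: tw; rewrite e ltnNge leqnSn.
by case: (odd k) next prev.
Qed.

(** Reduction to rank two, by induction on the length. Split off a maximal alternating prefix; the
    rest [v] is shorter and has neither [s] nor [t] as a descent, and [act w^-1%g (alpha s)] is a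
    combination of the images of [alpha s] and [alpha t] under [v^-1] with coefficients from
    [cheb]. *)
Lemma pos_left (s : S) w : (len w < len (val s * w)%g)%N -> pos (act w^-1%g (alpha s)).
Proof.
have [n] := ubnP (len w); elim: n s w => // n IH s w wn sw.
have [->|/eqP/len_left_descent[t tw]] := eqVneq w 1%g.
  by rewrite invg1 act1 pos_alpha.
have st : s <> t by move=> e; move: sw; rewrite tw e ltnNge leqnSn.
have tw' : (len (val t * w)%g < len w)%N by rewrite tw.
case: (max_alt_prefix s tw') => k [v [wE wl sv tv]].
have k0 : (0 < k)%N.
  case: k wE wl => // wE; move: tw'; have -> : w = v by rewrite wE /= mul1g.
  by rewrite ltnNge ltnW.
have vs : pos (act v^-1%g (alpha s)) by apply: IH => //; lia.
have vt : pos (act v^-1%g (alpha t)) by apply: IH => //; lia.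
(* A prefix of at least [m s t] letters could be rewritten by the braid relation to start with [s],
   and then [s] would shorten [w]. *)
have km : le_order k.+1 s t.
  rewrite /le_order; case E: (m s t) => [j|//]; rewrite ltnNge; apply/negP => jk.
  have [_ m0 _] := hm; case: j jk E => [_ /m0 //|j jk E].
  move: sw wE; rewrite -(subnKC jk) altD wprod_cat -(alt_braid E) altS wprod_cons => sw wE.
  set r := (if _ then _ else _) in wE.
  have := lenM (wprod (alt t s j)) (wprod r * v)%g; have := lenM (wprod r) v.
  have := len_le (alt t s j); have := len_le r.
  have -> : size r = (k - j.+1)%N by rewrite /r; case: ifP; rewrite size_alt.
  have -> : (wprod (alt t s j) * (wprod r * v))%g = (val s * w)%g.
    by rewrite wE -!mulgA genK.
  by rewrite size_alt; lia.
have c1 := cheb_ge0 st km; have c0 := cheb_ge0 st (le_orderW km).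
case: (alt_act s t k 0) => p [q [pq]]; rewrite scale1r scale0r addr0 add0n => e.
rewrite wE invgM actM e actD !actZ.
by apply: posD; apply: posZ => //; case: pq => -[pE qE]; rewrite ?pE ?qE.
Qed.

Lemma neg_left (s : S) w : (len (val s * w)%g < len w)%N -> pos (- act w^-1%g (alpha s)).
Proof.
move=> sw; have /pos_left : (len (val s * w)%g < len (val s * (val s * w))%g)%N.
  by rewrite genK.
by rewrite invgM genV actM act_gen_alpha actN.
Qed.

Lemma root_pos v : root v -> pos (- v) = ~~ pos v.
Proof.
move=> rv; have: ~~ (pos v && pos (- v)).
  by apply/negP => /andP[h1 h2]; apply: (root_neq0 rv); apply: pos_antisym.
have: pos v \/ pos (- v).
  case: rv => w [s ->]; rewrite -[w]invgK.
  case: (len_mull s w^-1%g) => e.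
    by left; apply: pos_left; rewrite e.
  by right; apply: neg_left; rewrite e.
by case: (pos v); case: (pos (- v)) => // -[].
Qed.

Lemma pos_leftE (s : S) w : pos (act w^-1%g (alpha s)) = (len w < len (val s * w)%g)%N.
Proof.
apply/idP/idP => [h|/pos_left //]; case: (len_mull s w) => e; first by rewrite e.
have: pos (- act w^-1%g (alpha s)) by apply: neg_left; rewrite e.
by rewrite root_pos ?h //; apply/root_act/root_alpha.
Qed.

Lemma pos_rightE w (s : S) : pos (act w (alpha s)) = (len w < len (w * val s)%g)%N.
Proof.
rewrite -{1}[w]invgK pos_leftE; have -> : (val s * w^-1)%g = (w * val s)^-1%g.
  by rewrite invgM genV.
by rewrite !lenV.
Qed.

Lemma wle_gen_pos (s : S) w : wle (val s) w = ~~ pos (act w^-1%g (alpha s)).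
Proof.
rewrite pos_leftE wle_gen; case: (len_mull s w) => ->.
  by rewrite ltnSn ltnNge leqnSn.
by rewrite ltnSn ltnNge leqnSn.
Qed.

(** If the maximal alternating prefix had fewer letters than [m s t], the computation of [pos_left]
    would make [act w^-1%g (alpha s)] positive, and [s] would be no descent. So the label is finite,
    and a braid move makes the start of the prefix [alt s t k]. *)
Lemma wle_dihedral s t w : s <> t -> wle (val s) w -> wle (val t) w ->
  exists k, [/\ m s t = Some k, len (wprod (alt s t k)) = k & wle (wprod (alt s t k)) w].
Proof.
move=> st; rewrite (wle_gen t); rewrite wle_gen_pos => sw.
move=> /(max_alt_prefix s)[k [v [wE wl sv tv]]].
have vs := pos_left sv; have vt := pos_left tv.
have [km|] := boolP (le_order k.+1 s t).
  have c1 := cheb_ge0 st km; have c0 := cheb_ge0 st (le_orderW km).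
  case: (alt_act s t k 0) => p [q [pq]]; rewrite scale1r scale0r addr0 add0n => e.
  case/negP: sw; rewrite wE invgM actM e actD !actZ.
  by apply: posD; apply: posZ => //; case: pq => -[pE qE]; rewrite ?pE ?qE.
rewrite /le_order; case E: (m s t) => [j|//]; rewrite -leqNgt => jk; exists j => //.
move: wE; rewrite -(subnKC jk) altD wprod_cat -(alt_braid E) -mulgA.
set r := (if _ then _ else _); set x := wprod (alt s t j) => wE.
have := wle_triangle x w; rewrite /wle wE mulKg -wE wl.
have := lenM (wprod r) v; have := len_le (alt s t j); have := len_le r.
have -> : size r = (k - j)%N by rewrite /r; case: ifP; rewrite size_alt.
rewrite size_alt -/x; have := lenM x (wprod r * v)%g; rewrite -wE wl.
move: (len (wprod r * v)%g) (len (wprod r)) (len x) (len v) => a b c d.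
by move=> h1 h2 h3 h4 h5; split=> //; [|apply/eqP]; lia.
Qed.

(** * Joins in the weak order *)

Lemma wle_mull q x a : wle q x -> wle a (q^-1 * x)%g -> wle q (q * a)%g /\ wle (q * a)%g x.
Proof.
rewrite wleE /wle => /eqP qx /eqP ax.
have := wle_triangle (q * a)%g x; have := lenM q a.
have e : ((q * a)^-1 * x = a^-1 * (q^-1 * x))%g by rewrite invgM mulgA.
rewrite e qx ax; move: (len (q * a)%g) (len q) (len a) (len (a^-1 * _)%g) => b c d f.
by move=> h1 h2; split; apply/eqP; lia.
Qed.

Lemma wle_step q z : wle q z -> q <> z ->
  exists s : S, wle q (q * val s)%g /\ wle (q * val s)%g z.
Proof.
move=> qz nqz; case: (@len_left_descent (q^-1 * z)%g) => [e|s sw].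
  by apply: nqz; rewrite -(mulVKg q z) e mulg1.
by exists s; apply: wle_mull => //; rewrite wle_gen sw.
Qed.

Lemma alt_descents s t k : m s t = Some k -> len (wprod (alt s t k)) = k ->
  wle (val s) (wprod (alt s t k)) /\ wle (val t) (wprod (alt s t k)).
Proof.
move=> E lk; have [_ m0 _] := hm; case: k E lk => [/m0 //|k] E lk.
rewrite !wle_gen lk {2}(alt_braid E) !altS !wprod_cons !genK.
by have := len_le (alt t s k); have := len_le (alt s t k); rewrite !size_alt.
Qed.

(* Newman's lemma: the common lower bounds of [x] and [y] above [q] are locally confluent by [wle_dihedral]. *)
Lemma wle_directed q x y z1 z2 : wle q z1 -> wle q z2 ->
    wle z1 x -> wle z1 y -> wle z2 x -> wle z2 y ->
  exists z, [/\ wle z1 z, wle z2 z, wle z x & wle z y].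
Proof.
have [n] := ubnP (len x - len q); elim: n q z1 z2 => // n IH q z1 z2 qn qz1 qz2 z1x z1y z2x z2y.
have [e1|/eqP /(wle_step qz1)[s [qs sz1]]] := eqVneq q z1.
  by exists z2; split; rewrite -?e1 ?wle_refl.
have [e2|/eqP /(wle_step qz2)[t [qt tz2]]] := eqVneq q z2.
  by exists z1; split; rewrite -?e2 ?wle_refl.
have step (r : S) : wle q (q * val r)%g -> wle (q * val r)%g x ->
    (len x - len (q * val r)%g < n)%N.
  rewrite wle_genr => h1 /wle_len h2; move: h1 h2 qn.
  by move: (len (q * val r)%g) (len q) (len x); clear; lia.
have sx := wle_trans sz1 z1x; have sy := wle_trans sz1 z1y.
have tx := wle_trans tz2 z2x; have ty := wle_trans tz2 z2y.
have [est|/eqP st] := eqVneq s t.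
  by apply: (IH (q * val s)%g) => //; [apply: step|rewrite est].
have cancel (r : S) u : wle q (q * val r)%g -> wle (q * val r)%g u ->
    wle q u -> wle (val r) (q^-1 * u)%g.
  by move=> h1 h2 h3; rewrite -(mulKg q (val r)) -wle_cancel.
have qx := wle_trans qz1 z1x; have qy := wle_trans qz1 z1y.
case: (wle_dihedral st (cancel _ _ qs sx qx) (cancel _ _ qt tx qx)) => k [mk lk Ax].
case: (wle_dihedral st (cancel _ _ qs sy qy) (cancel _ _ qt ty qy)) => k' [].
rewrite mk => -[<-] _ Ay {k'}; case: (alt_descents mk lk) => sA tA.
set A := wprod _ in lk Ax Ay sA tA.
case: (wle_mull qx Ax) => qA {}Ax; case: (wle_mull qy Ay) => _ {}Ay.
have sA' : wle (q * val s)%g (q * A)%g by rewrite (wle_cancel qs qA) !mulKg.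
have tA' : wle (q * val t)%g (q * A)%g by rewrite (wle_cancel qt qA) !mulKg.
have [z3 [h1 h2 h3 h4]] := IH _ z1 (q * A)%g (step _ qs sx) sz1 sA' z1x z1y Ax Ay.
have [z [g1 g2 g3 g4]] := IH _ z3 z2 (step _ qt tx) (wle_trans tA' h2) tz2 h3 h4 z2x z2y.
by exists z; split=> //; apply: wle_trans g1.
Qed.

(** Joins in the weak order exist only for elements with a common upper bound, here [b]. Minimality
    is first asked for below [b]. *)
Definition is_join (s : S) (p b x : W) : Prop :=
  [/\ wle p x, wle (val s) x, wle x b &
      forall y, wle p y -> wle (val s) y -> wle y b -> wle x y].

(** Directedness applied below both [x] and [y] gives an upper bound [z] of [p] and [val s] under
    both; [z] is below [b], so minimality puts [x] below [z]. *)
Lemma join_unbounded s p b x : is_join s p b x ->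
  forall y, wle p y -> wle (val s) y -> wle x y.
Proof.
case=> px sx xb xmin y py sy.
case: (wle_directed (wle1 p) (wle1 (val s)) px py sx sy) => z [pz sz zx zy].
by apply: wle_trans zy; apply: xmin => //; apply: wle_trans xb.
Qed.

Lemma join_exists s p b : wle p b -> wle (val s) b -> exists x, is_join s p b x.
Proof.
move=> pb sb.
pose P n := `[< exists x, [/\ wle p x, wle (val s) x, wle x b & len x = n] >].
have P0 : exists n, P n by exists (len b); apply/asboolP; exists b; rewrite wle_refl.
case: (ex_minnP P0) => n /asboolP[x [px sx xb xn]] nmin; exists x; split=> // y py sy yb.
case: (wle_directed (wle1 p) (wle1 (val s)) px py sx sy) => z [pz sz zx zy].
suff <- : z = x by [].
apply: wle_len_eq => //; rewrite xn; apply: nmin; apply/asboolP; exists z.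
by split=> //; apply: wle_trans xb.
Qed.

(** * Reflections and inversions *)

Lemma len_right_descent w : w <> 1%g -> exists s : S, len w = (len (w * val s)%g).+1.
Proof.
move=> w1; case: (@len_left_descent w^-1%g) => [e|s e].
  by apply: w1; rewrite -[w]invgK e invg1.
exists s; rewrite -lenV e; congr _.+1; rewrite -lenV; congr len.
by rewrite invgM invgK genV.
Qed.

Lemma act_faithful x y : (forall v, act x v = act y v) -> x = y.
Proof.
move=> e; suff h : (y^-1 * x)%g = 1%g by rewrite -(mulVKg y x) h mulg1.
have [//|/eqP/len_right_descent[s es]] := eqVneq (y^-1 * x)%g 1%g.
have := pos_rightE (y^-1 * x)%g s; rewrite actM e actK pos_alpha es.
by rewrite ltnNge leqnSn.
Qed.

Definition rrefl (g v : V) : V := v - (2 * B v g) *: g.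

Lemma act_refl x (s : S) v : act (x * val s * x^-1)%g v = rrefl (act x (alpha s)) v.
Proof.
rewrite !actM act_gen /srefl actD actVK -scaleNr actZ scaleNr.
by rewrite -B_alphar -(B_act x) actVK.
Qed.

Lemma root_refl g : root g -> exists r, forall v, act r v = rrefl g v.
Proof. by case=> x [s ->]; exists (x * val s * x^-1)%g => v; rewrite act_refl. Qed.

Lemma root_rrefl g h : root g -> root h -> root (rrefl g h).
Proof. by move=> /root_refl[r rE] rh; rewrite -rE; apply: root_act. Qed.

Lemma rreflN g v : rrefl (- g) v = rrefl g v.
Proof. by rewrite /rrefl BNr; apply: coordP => q; rewrite !coordE; ring. Qed.

Lemma root_scale c g h : root g -> root h -> h = c *: g -> h = g \/ h = - g.
Proof.
move=> rg rh e; have := B_root rh; rewrite e BZl BZr (B_root rg) mulr1 => /eqP.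
rewrite -expr2 sqrf_eq1 => /orP[] /eqP ->; [left|right].
  by rewrite scale1r.
by rewrite scaleN1r.
Qed.

(** The reflection changes only the coordinate at [s], so a sign change forces [g] to be a multiple
    of [alpha s], and both have norm 1. *)
Lemma pos_gen (s : S) g : root g -> pos g -> g <> alpha s -> pos (act (val s) g).
Proof.
move=> rg pg gs; have := root_pos (root_act (val s) rg).
case: (pos (act _ _)) => // /posP h.
have e : g = coord g s *: alpha s.
  apply: coordP => q; rewrite !coordE; case: eqVneq => [->|qs]; first by rewrite mulr1.
  have := h q; rewrite act_gen /srefl !coordE (negbTE qs) !mulr0 subr0 oppr_ge0 => hq.
  by apply/eqP; rewrite eq_le hq (posP _ pg).
case: (root_scale (root_alpha s) rg e) => // e'.
by case: (root_neq0 rg); apply: pos_antisym => //; rewrite e' opprK pos_alpha.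
Qed.

Lemma neg_gen (s : S) g : root g -> ~~ pos g -> g <> - alpha s -> ~~ pos (act (val s) g).
Proof.
move=> rg ng gs; rewrite -(root_pos (root_act _ rg)) -actN.
by apply: pos_gen; rewrite ?root_pos //; [apply: rootN|move/(congr1 -%R); rewrite opprK].
Qed.

Lemma inversions_finite w : exists l : seq V,
  forall g, root g -> pos g -> ~~ pos (act w g) -> g \in l.
Proof.
case: (wprod_gen w) => u <-; elim: u => [|s u [l IH]].
  by exists [::] => g _ pg; rewrite act1 pg.
exists (act (wprod u)^-1%g (alpha s) :: l) => g rg pg; rewrite wprod_cons actM => ng.
rewrite in_cons; have [pu|nu] := boolP (pos (act (wprod u) g)); last by rewrite IH ?orbT.
case: (eqVneq (act (wprod u) g) (alpha s)) => [<-|/eqP h]; first by rewrite actK eqxx.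
by move: ng; rewrite pos_gen //; apply: root_act.
Qed.

Definition disjoint_inversions (p w : W) : Prop :=
  forall g, root g -> pos g -> ~~ pos (act w^-1%g g) -> pos (act p g).

(** Extending [w'] by an ascent [t] adds exactly the inversion [act w' (alpha t)], and [p * w']
    ascends along [t] exactly when [p] keeps this root positive. *)
Lemma wle_inversions p w : wle p (p * w)%g <-> disjoint_inversions p w.
Proof.
have [n] := ubnP (len w); elim: n w => // n IH w wn.
have [->|/eqP/len_right_descent[t wt]] := eqVneq w 1%g.
  by rewrite mulg1 wle_refl; split=> // _ g _ pg; rewrite invg1 act1 pg.
set w' := (w * val t)%g in wt; have wE : w = (w' * val t)%g by rewrite /w' genKr.
clearbody w'.
have {}IH : wle p (p * w')%g <-> disjoint_inversions p w' by apply: IH; lia.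
have lw : (len w' < len (w' * val t)%g)%N by rewrite -wE wt.
have pa : pos (act w' (alpha t)) by rewrite pos_rightE.
have aN : act (w' * val t)^-1%g (act w' (alpha t)) = - alpha t.
  by rewrite invgM genV actM actK act_gen_alpha.
rewrite wE; split=> [pw|dis].
  have [pw' pwt] : wle p (p * w')%g /\ (len (p * w')%g < len (p * w' * val t)%g)%N.
    move: pw; rewrite !wleE mulgA => /eqP pw; have := lenM p w'.
    have := len_mulr (p * w')%g t; have := len_mulr w' t; rewrite pw; move: lw.
    move: (len (p * w')%g) (len (w' * val t)%g) (len w') (len p) => a b c d.
    by move=> h1 h2 h3 h4; split; [apply/eqP|]; lia.
  move=> g rg pg ng; have [pu|nu] := boolP (pos (act w'^-1%g g)); last by apply: (IH.1 pw').
  case: (eqVneq (act w'^-1%g g) (alpha t)) => [e|/eqP h].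
    by rewrite -(actVK w' g) e -actM pos_rightE.
  by move: ng; rewrite invgM genV actM pos_gen //; apply: root_act.
have /IH.2 : disjoint_inversions p w'.
  move=> g rg pg ng; apply: dis => //; rewrite invgM genV actM.
  apply: neg_gen => //; first exact: root_act.
  move=> e; have /pos_antisym := pg; rewrite -(actVK w' g) e actN opprK => /(_ pa).
  by apply/root_neq0/rootN/root_act/root_alpha.
have : pos (act (p * w')%g (alpha t)).
  by rewrite actM; apply: dis => //; [apply/root_act/root_alpha|
    rewrite aN root_pos ?pos_alpha //; apply: root_alpha].
rewrite pos_rightE !wleE [(p * (_ * _))%g]mulgA => h1 /eqP h2; apply/eqP.
have := len_mulr (p * w')%g t; have := len_mulr w' t; move: h1 h2 lw.
move: (len (p * w' * _)%g) (len (p * w')%g) (len (w' * val t)%g) (len w') (len p) => *; lia.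
Qed.

(** A geodesic from 1 through [p] to [b] crosses the wall of [g] at most once: a second sign change
    would be an inversion of the second piece undone by the first. *)
Lemma wle_not_cross p b g : wle p b -> root g ->
  pos (act p^-1%g g) != pos g -> pos (act b^-1%g g) = pos (act p^-1%g g).
Proof.
rewrite -{1}(mulVKg p b) => /wle_inversions; set w := (p^-1 * b)%g => dis.
have wlog_pos h : root h -> pos h -> ~~ pos (act p^-1%g h) -> ~~ pos (act b^-1%g h).
  move=> rh ph nh; rewrite -root_pos; last exact: root_act.
  apply/negPn/negP => nb; have /dis : pos (- act p^-1%g h).
    by rewrite root_pos //; apply: root_act.
  have -> : act w^-1%g (- act p^-1%g h) = - act b^-1%g h.
    by rewrite actN -actM /w invgM invgK mulgK.
  move=> /(_ (rootN (root_act _ rh)) nb); rewrite actN actVK root_pos // ph.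
  by [].
have rN x : root (act x g) -> pos (act x (- g)) = ~~ pos (act x g).
  by move=> rx; rewrite actN root_pos.
move=> rg; have rp := root_act p^-1%g rg; have rb := root_act b^-1%g rg.
case: (boolP (pos g)) => pg; case: (boolP (pos (act p^-1%g g))) => // h _.
  by apply/negbTE/wlog_pos.
have := @wlog_pos (- g) (rootN rg); rewrite root_pos // pg !rN // h.
by move=> /(_ isT isT); rewrite negbK.
Qed.

(** * Dominance and small roots *)

(** Dominance in the sense of Brink and Howlett: [g] dominates [h]. Small roots, also called
    elementary, dominate only themselves among the positive roots. *)
Definition dom (g h : V) : Prop := forall w, ~~ pos (act w g) -> ~~ pos (act w h).

Definition small (g : V) : Prop :=
  [/\ root g, pos g & forall h, root h -> pos h -> dom g h -> h = g].

Lemma small_alpha s : small (alpha s).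
Proof.
split; [exact: root_alpha|exact: pos_alpha|move=> h rh ph /(_ (val s))].
rewrite act_gen_alpha root_pos ?pos_alpha; last exact: root_alpha.
case: (eqVneq h (alpha s)) => // /eqP hs /(_ isT).
by rewrite pos_gen.
Qed.

(** The reflection by [t] permutes the positive roots other than [alpha t] and transports dominance,
    so besides itself [act (val t) g] can dominate only [alpha t]. *)
Lemma small_step (t : S) g : small g -> g <> alpha t -> ~ small (act (val t) g) ->
  dom (act (val t) g) (alpha t).
Proof.
move=> [rg pg gmin] gt; apply: contra_notP => ndom; split.
- exact: root_act.
- exact: pos_gen.
- move=> h rh ph hdom; have ht : h <> alpha t by move=> e; apply: ndom; rewrite -e.
  rewrite -(gmin (act (val t) h)).
  + by rewrite -actM gensq act1.
  + exact: root_act.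
  + exact: pos_gen.
  + by move=> w nw; rewrite -actM; apply: hdom; rewrite -actM -mulgA gensq mulg1.
Qed.

Lemma bf_gen (t : S) g s : bf (act (val t) g) s = bf g s - 2 * bf g t * gram t s.
Proof. by rewrite act_gen /srefl !BE. Qed.

(** Otherwise [act (val t) g] dominates [alpha t]. But its own reflection makes it negative and adds
    a positive multiple of it to [alpha t]. *)
Lemma small_descent (t : S) g : small g -> g <> alpha t -> 0 < bf g t ->
  small (act (val t) g).
Proof.
move=> sg gt b0; apply: contrapT => ns; have [rg pg _] := sg.
have rd := root_act (val t) rg; case: (root_refl rd) => r rE.
have := @small_step t g sg gt ns r; rewrite !rE.
have -> : rrefl (act (val t) g) (act (val t) g) = - act (val t) g.
  by rewrite /rrefl (B_root rd) mulr1 scaler_nat mulr2n opprD addNKr.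
rewrite (root_pos rd) pos_gen // => /(_ isT); rewrite /rrefl !BE bf_gen gram_diag.
rewrite -scaleNr posD ?pos_alpha //; apply: posZ; last exact: pos_gen.
by lra.
Qed.

Definition ht (v : V) : R := \sum_q coord v q.

Lemma htD u v : ht (u + v) = ht u + ht v.
Proof. by rewrite /ht -big_split; apply: eq_bigr => q _; rewrite coordE. Qed.

Lemma htZ a v : ht (a *: v) = a * ht v.
Proof. by rewrite /ht mulr_sumr; apply: eq_bigr => q _; rewrite coordE. Qed.

Lemma ht_alpha s : ht (alpha s) = 1.
Proof.
rewrite /ht (bigD1 s) //= coordE eqxx big1 ?addr0 // => q qs.
by rewrite coordE (negbTE qs).
Qed.

Lemma ht_gt0 v : root v -> pos v -> 0 < ht v.
Proof.
move=> rv /posP v0; rewrite lt_def; have h0 : 0 <= ht v by apply: sumr_ge0.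
rewrite h0 andbT; apply/negP; rewrite psumr_eq0 // => /allP h.
apply: (root_neq0 rv); apply: coordP => q; rewrite coordE.
by apply/eqP/(implyP (h q _))/isT; rewrite mem_index_enum.
Qed.

Lemma seq_injective_absurd (T : eqType) (f : nat -> T) (l : seq T) :
  injective f -> (forall n, f n \in l) -> False.
Proof.
move=> finj fl; have: (size (mkseq f (size l).+1) <= size l)%N.
  by apply: uniq_leq_size; [apply: mkseq_uniq|move=> _ /mapP[n _ ->]].
by rewrite size_mkseq ltnn.
Qed.

Lemma cheb_incr b n : 1 <= b -> 0 <= cheb b n /\ cheb b n + 1 <= cheb b n.+1.
Proof.
move=> b1; elim: n => [|n [IH1 IH2]]; first by rewrite /= add0r.
rewrite chebSS; have h : 0 <= (b - 1) * cheb b n.+1 by apply: mulr_ge0; lra.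
by split; lra.
Qed.

(* The roots [z_n = cheb b n.+1 *: g - cheb b n *: h] of the infinite dihedral group of [g] and [h]
   would all be inversions of one element. *)
Lemma B_ge1_comparable g h : root g -> root h -> 1 <= B g h -> dom g h \/ dom h g.
Proof.
move=> rg rh; set b := B g h => b1; apply: contrapT => /not_orP[].
move=> /existsNP[w /not_implyP[wg /negP/negPn wh]].
move=> /existsNP[w' /not_implyP[wh' /negP/negPn wg']].
pose z n := cheb b n.+1 *: g - cheb b n *: h.
have zSS n : z n.+2 = - rrefl (z n.+1) (z n) -> root (z n) -> root (z n.+1) -> root (z n.+2).
  by move=> -> r0 r1; apply: rootN; apply: root_rrefl.
have zrec n : B (z n) (z n.+1) = b -> z n.+2 = - rrefl (z n.+1) (z n).
  move=> e; rewrite /rrefl e /z !chebSS; apply: coordP => q; rewrite !coordE; ring.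
have zP n : [/\ root (z n), root (z n.+1) & B (z n) (z n.+1) = b].
  elim: n => [|n [r0 r1 e]].
    have z0 : z 0%N = g by rewrite /z /= scale1r scale0r subr0.
    have z1 : z 1%N = - rrefl g h.
      rewrite /rrefl (BC h) -/b /z /=; apply: coordP => q; rewrite !coordE; ring.
    rewrite z0 z1; split=> //; first by apply: rootN; apply: root_rrefl.
    by rewrite /rrefl !BE (B_root rg) (BC h) -/b; ring.
  split=> //; first by apply: zSS => //; apply: zrec.
  rewrite zrec // /rrefl BNr BDr BNr BZr (B_root r1) (BC (z n.+1)) e; ring.
have rz n : root (z n) by case: (zP n).
case: (inversions_finite (w * w'^-1)%g) => l lP.
apply: (@seq_injective_absurd _ (fun n => act w' (z n)) l).
  have hg := ht_gt0 (root_act w' rg) wg'.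
  have hh : 0 < ht (- act w' h).
    by apply: ht_gt0; [apply/rootN/root_act|rewrite root_pos //; apply: root_act].
  have hS n : ht (act w' (z n)) < ht (act w' (z n.+1)).
    rewrite /z !actD !actN !actZ -!scalerN !htD !htZ.
    have [c1 c2] := cheb_incr n b1; have [c3 c4] := cheb_incr n.+1 b1.
    move: (cheb b n) (cheb b n.+1) (cheb b n.+2) c1 c2 c3 c4 => u0 u1 u2 c1 c2 c3 c4.
    by apply: ltr_leD; [rewrite ltr_pM2r // | rewrite ler_pM2r //]; lra.
  have hmono : {homo (fun n => ht (act w' (z n))) : i j / (i < j)%N >-> i < j}.
    by apply: homo_ltn => //; apply: lt_trans.
  move=> i j e; case: (ltngtP i j) => // /hmono; rewrite e ltxx //.
move=> n; apply: lP; first exact: root_act.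
  rewrite /z actD actN !actZ -scalerN; have [c1 c2] := cheb_incr n b1.
  apply: posD; apply: posZ => //; first lra.
  by rewrite root_pos //; apply: root_act.
rewrite actM actK -root_pos; last exact: root_act.
rewrite /z actD actN !actZ opprD opprK -scalerN; have [c1 c2] := cheb_incr n b1.
apply: posD; apply: posZ => //; first lra.
by rewrite root_pos //; apply: root_act.
Qed.

Lemma small_B_lt1 g h : small g -> small h -> g <> h -> B g h < 1.
Proof.
move=> [rg pg gmin] [rh ph hmin] gh; rewrite ltNge; apply/negP.
move=> /(B_ge1_comparable rg rh)[/gmin e|/hmin e].
  by apply: gh; rewrite e.
by apply: gh; rewrite e.
Qed.

(** * Finitely many values of the form *)

(** Such a functional can be moved into the closed fundamental chamber: if it is negative on
    [alpha s], composing it with the reflection by [s] removes one root from the list and permutes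
    the others. *)
Lemma functional_descent (f : V -> R) (l : seq V) :
  (forall u v, f (u + v) = f u + f v) -> (forall a v, f (a *: v) = a * f v) ->
  (forall g, root g -> pos g -> f g < 0 -> g \in l) ->
  exists x, forall s, 0 <= f (act x (alpha s)).
Proof.
have [n] := ubnP (size l); elim: n f l => // n IH f l ln fD fZ fl.
have [h|/existsNP[s /negP]] := EM (forall s, 0 <= f (alpha s)).
  by exists 1%g => s; rewrite act1.
rewrite -ltNge => fs; have sl : alpha s \in l.
  by apply: fl => //; [apply: root_alpha|apply: pos_alpha].
pose l' := [seq act (val s) g | g <- l & g != alpha s].
case: (IH (fun v => f (act (val s) v)) l') => [||||x xP].
- rewrite size_map size_filter -(count_predC (pred1 (alpha s)) l) in ln *.
  move: sl; rewrite -has_pred1 has_count; move: ln.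
  by move: (count _ _) (count _ _) => a b; lia.
- by move=> u v; rewrite actD fD.
- by move=> a v; rewrite actZ fZ.
- move=> g rg pg fg; apply/mapP; exists (act (val s) g); last first.
    by rewrite -actM gensq act1.
  have gs : g <> alpha s.
    move=> e; move: fg; rewrite e act_gen_alpha -scaleN1r fZ; lra.
  rewrite mem_filter fl //; [|exact: root_act|exact: pos_gen].
  rewrite andbT; apply/eqP => e; apply: (root_neq0 rg); apply: pos_antisym => //.
  have -> : g = act (val s) (act (val s) g) by rewrite -actM gensq act1.
  by rewrite e act_gen_alpha opprK pos_alpha.
- by exists (val s * x)%g => t; rewrite actM.
Qed.

(** The product of the two reflections is a rotation of the plane of [g] and [h], with cosine
    [C = 2 * c ^+ 2 - 1]. Squaring replaces [C] by [2 * C ^+ 2 - 1], which at least doubles [1 - C]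
    while [C] is positive. Once [C <= 0], take [a = - (2 * C)]; its sign makes the average over 1,
    [x] and its square a combination with nonnegative weights. *)
Lemma rotation_annihilator g h : root g -> root h -> `|B g h| < 1 ->
  exists x a, [/\ 0 <= a, act x (act x g) = - a *: act x g - g &
                  act x (act x h) = - a *: act x h - h].
Proof.
move=> rg rh c1.
suff main n C x : C < 1 -> 1 <= 2 ^+ n * (1 - C) ->
    act x (act x g) = (2 * C) *: act x g - g ->
    act x (act x h) = (2 * C) *: act x h - h ->
    exists x a, [/\ 0 <= a, act x (act x g) = - a *: act x g - g &
                    act x (act x h) = - a *: act x h - h].
  case: (root_refl rg) => rr rrE; case: (root_refl rh) => tt ttE.
  set c := B g h in c1; pose C := 2 * c ^+ 2 - 1.
  have C1 : C < 1.
    rewrite /C; have : c ^+ 2 < 1 by rewrite -real_normK ?num_real // expr_lt1.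
    lra.
  have [n nP] : exists n, 1 <= 2 ^+ n * (1 - C).
    pose k := Num.bound (1 - C)^-1; exists k.
    have : (1 - C)^-1 < k%:R.
      have := archi_boundP (x := (1 - C)^-1); apply.
      by rewrite invr_ge0; lra.
    rewrite -(ltr_pM2r (x := 1 - C)); last lra.
    rewrite mulVf; last by apply/eqP; lra.
    move=> /ltW /le_trans; apply; rewrite ler_pM2r; last lra.
    by rewrite -natrX ler_nat ltnW // ltn_expl.
  apply: (main n C (rr * tt)%g C1 nP);
    rewrite !actM !(rrE, ttE) /rrefl !BE ?(B_root rg) ?(B_root rh) ?(BC h g) -/c;
    by apply: coordP => q; rewrite !coordE /C; ring.
elim: n C x => [|n IH] C x C1 nC xg xh.
  exists x, (- (2 * C)); rewrite opprK; split=> //; move: nC; rewrite expr0 mul1r; lra.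
have [C0|C0] := lerP C 0.
  by exists x, (- (2 * C)); rewrite opprK; split=> //; lra.
have sq v : act x (act x v) = (2 * C) *: act x v - v ->
    act (x * x)%g (act (x * x)%g v) = (2 * (2 * C ^+ 2 - 1)) *: act (x * x)%g v - v.
  move=> xv; have xv3 : act x (act x (act x v)) = (2 * C) *: act x (act x v) - act x v.
    by rewrite {1}xv actD actZ actN.
  have xv4 : act x (act x (act x (act x v))) =
      (2 * C) *: act x (act x (act x v)) - act x (act x v).
    by rewrite {1}xv3 actD actZ actN.
  rewrite !actM xv4 xv3 xv; apply: coordP => q; rewrite !coordE; ring.
apply: (IH (2 * C ^+ 2 - 1) (x * x)%g); try exact: sq.
  have : C ^+ 2 < 1 by rewrite expr_lt1 // ltW.
  lra.
apply: le_trans nC _; rewrite exprSr -mulrA ler_pM2l ?exprn_gt0 //.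
have : 0 <= C * (1 - C) by apply: mulr_ge0; lra.
by rewrite expr2; lra.
Qed.

(* Averaging the height over the rotation [x] gives a functional that vanishes on [g] and [h] and is
   positive on almost all positive roots; [functional_descent] moves its zero set into a finite
   standard parabolic subsystem. *)
Lemma B_finite_values : exists vl : seq R,
  forall g h, root g -> root h -> `|B g h| < 1 -> B g h \in vl.
Proof.
pose supp (J : {set S}) g := forall q, q \notin J -> coord g q = 0.
pose covers J (l : seq V) := forall g, root g -> pos g -> supp J g -> g \in l.
(* The subset [J] found below depends on [g] and [h], so the values are collected in advance over
   all [J] with finitely many positive roots; negatives are added since roots are moved into [L J]
   only up to sign. *)
have /boolp.choice[L LP] : forall J, exists L, (exists l, covers J l) -> covers J L.
  move=> J.
  have [[l lP]|no] := EM (exists l, covers J l); first by exists l.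
  by exists [::] => /no.
pose vals J := [seq B u v | u <- L J, v <- L J].
exists (flatten [seq vals J ++ map -%R (vals J) | J <- enum {set S}]) => g h rg rh c1.
case: (rotation_annihilator rg rh c1) => x [a [a0 xg xh]].
pose f v := ht v + a * ht (act x v) + ht (act x (act x v)).
have fD u v : f (u + v) = f u + f v by rewrite /f !actD !htD; ring.
have fZ c v : f (c *: v) = c * f v by rewrite /f !actZ !htZ; ring.
have fN v : f (- v) = - f v by rewrite -scaleN1r fZ mulN1r.
have f0 v : act x (act x v) = - a *: act x v - v -> f v = 0.
  by move=> e; rewrite /f e htD htZ -scaleN1r htZ; ring.
have [l1 l1P] := inversions_finite x; have [l2 l2P] := inversions_finite (x * x)%g.
have fl v : root v -> pos v -> f v <= 0 -> v \in l1 ++ l2.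
  move=> rv pv fv; rewrite mem_cat; apply/orP.
  have [p1|n1] := boolP (pos (act x v)); last by left; apply: l1P.
  have [p2|n2] := boolP (pos (act (x * x)%g v)); last by right; apply: l2P.
  rewrite actM in p2; have h0 := ht_gt0 rv pv.
  have h1 := ht_gt0 (root_act x rv) p1; have h2 := ht_gt0 (root_act x (root_act x rv)) p2.
  have : 0 <= a * ht (act x v) by rewrite mulr_ge0 // ltW.
  by move: fv; rewrite /f; lra.
have [y yP] := functional_descent fD fZ (fun v rv pv h => fl v rv pv (ltW h)).
pose J := [set s | f (act y (alpha s)) == 0].
have vE v : v = \sum_s coord v s *: alpha s.
  apply: coordP => q; rewrite {2}/coord sum_ffunE (bigD1 q) //= big1 ?addr0.
    by rewrite -[LHS]mulr1 ffunE /= -/(coord _ _) coordE eqxx.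
  move=> s sq; rewrite ffunE -/(coord _ _) coordE eq_sym (negbTE sq); exact: mulr0.
have fsum v : f (act y v) = \sum_s coord v s * f (act y (alpha s)).
  have f00 : f (act y 0) = 0 by rewrite -(scale0r 0) actZ fZ mul0r.
  have fD' u u' : f (act y (u + u')) = f (act y u) + f (act y u') by rewrite actD fD.
  rewrite {1}(vE v) (big_morph (fun u => f (act y u)) fD' f00); apply: eq_bigr => s _.
  by rewrite actZ fZ.
have finJ : exists l, covers J l.
  have [l3 l3P] := inversions_finite y; exists (map (act y^-1%g) (l1 ++ l2) ++ l3).
  move=> v rv pv Jv; rewrite mem_cat; apply/orP.
  have [p|n] := boolP (pos (act y v)); last by right; apply: l3P.
  left; apply/mapP; exists (act y v); last by rewrite actK.
  apply: fl => //; first exact: root_act.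
  rewrite fsum big1 // => s _; have [|/Jv ->] := boolP (s \in J); last exact: mul0r.
  by rewrite inE => /eqP ->; rewrite mulr0.
have inL v : root v -> pos v -> f (act y v) = 0 -> v \in L J.
  move=> rv pv fv; apply: (LP J finJ) => // q; rewrite inE => fq.
  move: fv => /eqP; rewrite fsum psumr_eq0 => [/allP /(_ q)|s _]; last first.
    by apply: mulr_ge0 => //; apply: (posP _ pv).
  by rewrite mem_index_enum => /(_ isT) /=; rewrite mulf_eq0 (negbTE fq) orbF => /eqP.
have split v : root v -> f v = 0 -> exists2 u, u \in L J & act y^-1%g v = u \/ act y^-1%g v = - u.
  move=> rv fv; have ru := root_act y^-1%g rv.
  have [p|n] := boolP (pos (act y^-1%g v)).
    by exists (act y^-1%g v); [apply: inL; rewrite ?actVK|left].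
  exists (- act y^-1%g v); last by right; rewrite opprK.
  by apply: inL; rewrite ?root_pos ?actN ?actVK ?fN ?fv ?oppr0 //; apply: rootN.
have [u uL ue] := split g rg (f0 g xg); have [v vL ve] := split h rh (f0 h xh).
have uv : B u v \in vals J by apply/allpairsP; exists (u, v).
apply/flattenP; exists (vals J ++ map -%R (vals J)).
  by apply/mapP; exists J; rewrite // mem_enum.
rewrite -(B_act y^-1%g) mem_cat; case: ue => ->; case: ve => ->;
  rewrite ?BNl ?BNr ?opprK ?uv //; apply/orP; right; exact: map_f.
Qed.
(** * Finiteness of the set of small roots *)

(** A chain of small roots; a negative [bf g t] means that the step adds a positive multiple of
    [alpha t]. *)
Fixpoint ascending (g : V) (u : seq S) : Prop :=
  small g /\ if u is t :: u' then bf g t < 0 /\ ascending (act (val t) g) u' else True.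

Definition walk (g : V) (u : seq S) : V := foldl (fun h t => act (val t) h) g u.

Lemma ascending_small g u : ascending g u -> small g.
Proof. by case: u => [|t u] []. Qed.

Lemma walk_cat g u v : walk g (u ++ v) = walk (walk g u) v.
Proof. exact: foldl_cat. Qed.

Lemma ascending_cat g u v :
  ascending g (u ++ v) -> ascending g u /\ ascending (walk g u) v.
Proof.
elim: u g => [|t u IH] g /=; first by move=> h; split=> //; have := ascending_small h.
by case=> sg [gt /IH[h1 h2]].
Qed.

Lemma gram_le0 s t : s <> t -> gram s t <= 0.
Proof.
move=> st; have : 0 <= cheb (- gram s t) 2.
  apply: cheb_ge0 => //; rewrite /le_order; case E: (m s t) => [k|//].
  exact: m_offdiag st E.
by rewrite /=; lra.
Qed.

Lemma ascending_step_gt (t : S) g : small g -> small (act (val t) g) -> bf g t < 0 -> -1 < bf g t.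
Proof.
move=> sg stg b0; have ne : act (val t) g <> alpha t.
  have [rg pg _] := sg => e; apply: (root_neq0 rg); apply: pos_antisym => //.
  have -> : g = act (val t) (act (val t) g) by rewrite -actM gensq act1.
  by rewrite e act_gen_alpha opprK pos_alpha.
have := small_B_lt1 stg (small_alpha t) ne; rewrite B_alphar bf_gen gram_diag.
by lra.
Qed.

(** Off-diagonal entries of [gram] are nonpositive, so steps by other letters only lower the value
    at [s]; a step by [s] would need a value above -1. *)
Lemma ascending_notin g u s : ascending g u -> bf g s <= -1 -> s \notin u.
Proof.
elim: u g => //= t u IH g [sg [gt asc]] gs.
have /eqP ts : t <> s.
  move=> e; have := ascending_step_gt sg (ascending_small asc) gt; rewrite e; lra.
rewrite in_cons negb_or eq_sym ts /=; apply: IH asc _; rewrite bf_gen.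
have : 0 <= bf g t * gram t s.
  by apply: mulr_le0; [exact: ltW|apply/gram_le0/eqP].
by lra.
Qed.

Lemma ascending_ht g u : ascending g u -> u <> [::] -> ht g < ht (walk g u).
Proof.
have le h v : ascending h v -> ht h <= ht (walk h v).
  elim: v h => //= t v IH h [_ [ht0 /IH]]; apply: le_trans.
  rewrite act_gen /srefl -scaleNr htD htZ ht_alpha; lra.
case: u => //= t u [_ [gt /le]] h _; apply: lt_le_trans h.
rewrite act_gen /srefl -scaleNr htD htZ ht_alpha; lra.
Qed.

Lemma walk_coord g u q : q \notin u -> coord (walk g u) q = coord g q.
Proof.
elim: u g => //= t u IH g; rewrite in_cons negb_or => /andP[qt /IH ->].
by rewrite act_gen /srefl !coordE (negbTE qt) mulr0 subr0.
Qed.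

(** The difference of the two end roots is supported on the letters of [u], hence orthogonal to
    itself. Both roots have norm 1, so their product is 1, which is impossible for distinct small
    roots. *)
Lemma ascending_no_repeat g u : ascending g u -> u <> [::] ->
  (forall s, s \in u -> bf g s = bf (walk g u) s) -> False.
Proof.
move=> asc u0 e; set h := walk g u in e.
have sg := ascending_small asc; have [rg _ _] := sg.
have sh : small h.
  by move: asc; rewrite -{1}(cats0 u) => /ascending_cat[_ /ascending_small].
have [rh _ _] := sh.
have gh : g <> h by move=> gh; have := ascending_ht asc u0; rewrite -/h gh ltxx.
have eB : B (h - g) g = B (h - g) h.
  apply: eq_bigr => s _; have [/e -> //|su] := boolP (s \in u).
  by rewrite !coordE walk_coord // subrr !mul0r.
have := small_B_lt1 sg sh gh; move: eB.
rewrite !BDl !BNl (B_root rg) (B_root rh) (BC h g); lra.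
Qed.

(* Once [bf g s <= -1], the letter [s] never occurs again, so by induction on [U] only boundedly many
   steps follow; before that, the values [bf g s] stay in a finite set and cannot all recur. *)
Lemma ascending_bounded (U : {set S}) : exists N, forall g u,
  ascending g u -> {subset u <= U} -> (size u <= N)%N.
Proof.
have [n] := ubnP #|U|; elim: n U => // n IH U Un.
have /boolp.choice[N NP] : forall s : S, exists N, s \in U -> forall g u,
    ascending g u -> {subset u <= U :\ s} -> (size u <= N)%N.
  move=> s; have [sU|] := boolP (s \in U); last by exists 0%N.
  have [|N NP] := IH (U :\ s); last by exists N.
  by move: Un; rewrite (cardsD1 s U) sU.
have [vl vlP] := B_finite_values.
(* The value 1 arises when the current root is [alpha s]. [M] counts the tables of indices into
   [vals], so two of the roots after 0 to [M] steps share a table. *)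
pose vals := 1 :: vl; pose k := (size vals).+1.
pose M := #|{ffun S -> 'I_k}|.
exists (M + \sum_(s in U) N s)%N => g u asc uU; rewrite leqNgt; apply/negP => big.
have drop_asc i : ascending (walk g (take i u)) (drop i u).
  by move: asc; rewrite -{1}(cat_take_drop i u) => /ascending_cat[].
have gtN1 i s : (i <= M)%N -> s \in U -> -1 < bf (walk g (take i u)) s.
  move=> iM sU; rewrite ltNge; apply/negP => /(ascending_notin (drop_asc i)) su.
  have : (size (drop i u) <= N s)%N.
    apply: NP (drop_asc i) _ => // t tu; rewrite !inE (uU _ (mem_drop tu)) andbT.
    by apply: contraNneq su => <-.
  rewrite size_drop; move: big; rewrite (bigD1 s sU) /=; move: (N s) (\sum_(_ | _) _)%N => a b.
  by move: iM; clear; lia.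
have in_vals i s : (i <= M)%N -> s \in U -> bf (walk g (take i u)) s \in vals.
  move=> iM sU; have sm := ascending_small (drop_asc i); have [rw _ _] := sm.
  rewrite inE; have [->|/eqP ne] := eqVneq (walk g (take i u)) (alpha s).
    by rewrite bf_alpha gram_diag eqxx.
  apply/orP; right; rewrite -B_alphar; apply: vlP => //; first exact: root_alpha.
  have := small_B_lt1 sm (small_alpha s) ne; have := gtN1 i s iM sU.
  by rewrite B_alphar ltr_norml => -> ->.
pose F (i : 'I_M.+1) := [ffun s => inord (index (bf (walk g (take i u)) s) vals) : 'I_k].
have /injectivePn[i [j ij Fij]] : ~~ injectiveb F.
  by apply/injectiveP => /leq_card; rewrite card_ord ltnn.
wlog ltij : i j ij Fij / (i < j)%N.
  move=> h; case: (ltngtP i j) => [|lt|/val_inj e]; first exact: h.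
    by apply: (h j i); rewrite // eq_sym.
  by rewrite e eqxx in ij.
have bE s : s \in U -> bf (walk g (take i u)) s = bf (walk g (take j u)) s.
  move=> sU; have vi := in_vals i s (ltn_ord i) sU; have vj := in_vals j s (ltn_ord j) sU.
  move/ffunP: Fij => /(_ s); rewrite !ffunE => /(congr1 (@nat_of_ord _)).
  rewrite !inordK ?ltnS ?index_size // => e.
  by rewrite -(nth_index 0 vi) e nth_index.
have ju : (j < size u)%N.
  by apply: leq_trans big; rewrite ltnS (leq_trans _ (leq_addr _ _)) // -ltnS.
have take_j : take j u = take i u ++ take (j - i) (drop i u).
  by rewrite -{1}(subnKC (ltnW ltij)) takeD.
apply: (@ascending_no_repeat (walk g (take i u)) (take (j - i) (drop i u))).
- have := drop_asc i; rewrite -{1}(cat_take_drop (j - i) (drop i u)).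
  by case/ascending_cat.
- move=> /(congr1 size); rewrite size_take size_drop ltn_sub2r //; last exact: ltn_trans ju.
  by move/eqP; rewrite subn_eq0 leqNgt ltij.
- move=> s su; rewrite -walk_cat -take_j; apply: bE; apply: uU.
  by apply: mem_drop (mem_take su).
Qed.

(** A small root that is not simple has [bf h t > 0] for some [t], because [B h h = 1] and its
    coordinates are nonnegative; reflecting by [t] keeps it small. Read backwards, this descent is
    an ascending chain, so it reaches a simple root within [N] steps. *)
Lemma small_finite : exists l : seq V, forall g, small g -> g \in l.
Proof.
have [N NP] := ascending_bounded [set: S].
exists [seq walk (alpha p.1) (val p.2) | p : S * (N.-bseq S)] => g sg.
have main n : (exists s u, ascending (alpha s) u /\ walk (alpha s) u = g) \/
    (exists h u, [/\ ascending h u, walk h u = g & size u = n]).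
  elim: n => [|n [h|[h [u [asc ug un]]]]]; [|by left|].
    by right; exists g, [::].
  have [[s e]|nsimple] := EM (exists s, h = alpha s).
    by left; exists s, u; rewrite -e.
  have sh := ascending_small asc; have [rh /posP ph _] := sh.
  have [t ht] : exists t, 0 < bf h t.
    apply: contrapT => /forallNP no; have := B_root rh.
    suff : B h h <= 0 by lra.
    apply: sumr_le0 => t _; apply: mulr_ge0_le0 => //.
    by rewrite leNgt; apply/negP/no.
  right; exists (act (val t) h), (t :: u).
  rewrite /= -actM gensq act1 bf_gen gram_diag un; split=> //; split.
    by apply: small_descent => // e; apply: nsimple; exists t.
  by split=> //; lra.
case: (main N.+1) => [[s [u [asc ug]]]|[h [u [asc _ un]]]]; last first.
  by have := NP _ _ asc; rewrite un ltnn => h0; case: (notF (h0 _)) => t; rewrite inE.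
have uN : (size u <= N)%N by apply: NP asc _ => t; rewrite inE.
by apply/mapP; exists (s, Bseq uN); rewrite ?mem_enum //= ug.
Qed.

(** * Joins with a generator *)

Definition same_small_inversions (p p' : W) : Prop :=
  forall g, small g -> pos (act p g) = pos (act p' g).

(** Small inversions act as states of an automaton. They tell which letters extend [p], and they
    update: after [t], the sign at a small [g] other than [alpha t] is the sign of [p] at
    [act (val t) g], which is small or else dominates the positive [alpha t]. *)
Lemma same_cone_type p p' w : same_small_inversions p p' ->
  wle p (p * w)%g -> wle p' (p' * w)%g.
Proof.
have [n] := ubnP (len w); elim: n p p' w => // n IH p p' w wn pp' pw.
have [->|/eqP/len_left_descent[t tw]] := eqVneq w 1%g; first by rewrite mulg1 wle_refl.
have [pt ptw] : wle p (p * val t)%g /\ wle (p * val t)%g (p * w)%g.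
  by apply: wle_mull => //; rewrite mulKg wle_gen tw.
have pa : pos (act p (alpha t)) by rewrite pos_rightE -wle_genr.
have pa' : pos (act p' (alpha t)) by rewrite -pp' //; apply: small_alpha.
have wE : w = (val t * (val t * w))%g by rewrite genK.
have tt : wle p' (p' * val t)%g by rewrite wle_genr -pos_rightE.
apply: (wle_trans tt); rewrite wE mulgA.
apply: (IH (p * val t)%g); first by rewrite tw in wn.
  move=> g sg; rewrite !actM; case: (eqVneq g (alpha t)) => [->|/eqP gt].
    rewrite act_gen_alpha !actN !root_pos ?pa ?pa' //; exact/root_act/root_alpha.
  have [/pp' //|ns] := EM (small (act (val t) g)).
  have d := small_step sg gt ns.
  have key q : pos (act q (alpha t)) -> pos (act q (act (val t) g)).
    by move=> pq; apply/negPn/negP => /d; rewrite pq.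
  by rewrite !key.
by rewrite -mulgA -wE.
Qed.

(** Let [d] be dominated by this root. The quotient of [b] by [p] has both as inversions, so
    [act p d] is positive; dominance tested on [val s * p] makes it negative after [s], and only
    [alpha s] changes sign in this way. *)
Lemma small_inverse_root s p b : wle p b -> wle (val s) b -> ~~ wle (val s) p ->
  small (act p^-1%g (alpha s)).
Proof.
rewrite -{1}(mulVKg p b) => /wle_inversions; set w := (p^-1 * b)%g => dis.
rewrite !wle_gen_pos => sb /negPn sp.
split=> //; first exact/root_act/root_alpha.
move=> d rd pd dm; have pdp : pos (act p d).
  by apply: dis => //; apply: dm; rewrite -actM /w invgM invgK mulgK.
have := dm (val s * p)%g; rewrite !actM actVK act_gen_alpha root_pos; last exact: root_alpha.
rewrite pos_alpha => /(_ isT) nd.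
case: (eqVneq (act p d) (alpha s)) => [<-|/eqP h]; first by rewrite actK.
by move: nd; rewrite pos_gen //; apply: root_act.
Qed.

(* The quotient [p^-1 * x] is determined by the small root [p^-1 alpha_s] and the small inversions
   of [p], which leaves finitely many possibilities. *)
Lemma join_bounded : exists C, forall s p b x, is_join s p b x ->
  (len (p^-1 * x)%g <= C)%N.
Proof.
have [l lP] := small_finite.
pose n := size l.
pose state s p : 'I_n.+1 * {set 'I_n} :=
  (inord (index (act p^-1%g (alpha s)) l),
   [set i : 'I_n | pos (act p (nth 0 l i))]).
pose good k sg := exists s p b x,
  [/\ is_join s p b x, ~~ wle (val s) p, state s p = sg & len (p^-1 * x)%g = k].
have /boolp.choice[C CP] : forall sg, exists k, (exists k', good k' sg) -> good k sg.
  move=> sg; have [[k gk]|no] := EM (exists k', good k' sg); first by exists k.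
  by exists 0%N => /no.
exists (\max_sg C sg) => s p b x jx; have [px sx xb xmin] := jx.
have [sp|sp] := boolP (wle (val s) p).
  suff -> : x = p by rewrite mulVg len1.
  apply: wle_len_eq; last exact: wle_len.
  by apply: xmin => //; [apply: wle_refl|apply: wle_trans xb].
apply: leq_trans (leq_bigmax (state s p)).
have [s0 [p0 [b0 [x0 [[px0 sx0 xb0 _] sp0 st <-]]]]] : good (C (state s p)) (state s p).
  by apply: CP; exists (len (p^-1 * x)%g), s, p, b, x.
have pb := wle_trans px xb; have sb := wle_trans sx xb.
have pb0 := wle_trans px0 xb0; have sb0 := wle_trans sx0 xb0.
have sm := lP _ (small_inverse_root pb sb sp).
have sm0 := lP _ (small_inverse_root pb0 sb0 sp0).
move: st => [/(congr1 (@nat_of_ord _)) e1 e2].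
rewrite !inordK ?ltnS ?index_size // in e1.
have betaE : act p^-1%g (alpha s) = act p0^-1%g (alpha s0).
  by rewrite -(nth_index 0 sm) -e1 nth_index.
have same : same_small_inversions p0 p.
  move=> g /lP gl; have gi : (index g l < n)%N by rewrite index_mem.
  by move/setP: e2 => /(_ (Ordinal gi)); rewrite !inE /= nth_index.
(* Transport of the reference quotient: [p * u] is an upper bound of [p] and [val s], so it lies
   above the join [x], which bounds the length. *)
set u := (p0^-1 * x0)%g.
have pu : wle p (p * u)%g by apply: same_cone_type same _; rewrite mulVKg.
have su : wle (val s) (p * u)%g.
  rewrite wle_gen_pos invgM actM betaE -actM -invgM /u mulVKg -wle_gen_pos.
  exact: sx0.
have xu := join_unbounded jx pu su.
by have := wle_between px xu; rewrite mulKg => ->; rewrite leq_addr.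
Qed.

(** * Walls and tracking *)

Definition sep (g : V) (x y : W) : bool := pos (act x^-1%g g) != pos (act y^-1%g g).

Lemma sepD g x y z : sep g x z = sep g x y (+) sep g y z.
Proof.
rewrite /sep; case: (pos (act x^-1%g g)); case: (pos (act y^-1%g g));
  by case: (pos (act z^-1%g g)).
Qed.

Lemma sepC g x y : sep g x y = sep g y x.
Proof. by rewrite /sep eq_sym. Qed.

Lemma sepxx g x : sep g x x = false.
Proof. by rewrite /sep eqxx. Qed.

Lemma sepN g x y : root g -> sep (- g) x y = sep g x y.
Proof.
move=> rg; rewrite /sep !actN !root_pos; try exact: root_act.
by case: (pos _); case: (pos _).
Qed.

Lemma sep_gen (s : S) x y : sep (act x (alpha s)) x y = wle (val s) (x^-1 * y)%g.
Proof. by rewrite wle_gen_pos /sep actK pos_alpha invgM invgK actM; case: (pos _). Qed.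

Lemma sep_edge (s : S) x g : root g -> sep g x (x * val s)%g ->
  act x (alpha s) = g \/ act x (alpha s) = - g.
Proof.
move=> rg; rewrite /sep invgM genV actM => h; have rx := root_act x^-1%g rg.
case: (eqVneq (act x^-1%g g) (alpha s)) => [<-|/eqP h1]; first by left; rewrite actVK.
case: (eqVneq (act x^-1%g g) (- alpha s)) => [e|/eqP h2].
  by right; rewrite -[alpha s]opprK -e actN actVK.
have [p|n] := boolP (pos (act x^-1%g g)).
  by move: h; rewrite pos_gen // p.
by move: h; rewrite (negbTE n) (negbTE (neg_gen rx n h2)).
Qed.

Definition between (x y z : W) : Prop :=
  len (x^-1 * z)%g = (len (x^-1 * y)%g + len (y^-1 * z)%g)%N.

Lemma betweenE x y z : between x y z <-> wle (x^-1 * y)%g (x^-1 * z)%g.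
Proof.
rewrite /between /wle invgM invgK -mulgA (mulVKg x).
by split=> [/eqP|/eqP].
Qed.

Lemma dC x y : len (x^-1 * y)%g = len (y^-1 * x)%g.
Proof. by rewrite -lenV invgM invgK. Qed.

Lemma betweenC x y z : between x y z -> between z y x.
Proof. by rewrite /between (dC z x) (dC z y) (dC y x) addnC. Qed.

Lemma between_right x y : between x y y.
Proof. by rewrite /between mulVg len1 addn0. Qed.

Lemma sep_between g x y z : root g -> between x y z -> sep g x y -> sep g y z = false.
Proof.
move=> rg /betweenE/wle_not_cross h sxy.
have := h _ (root_act x^-1%g rg); rewrite -!actM !invgM !invgK !mulgK.
rewrite eq_sym => /(_ sxy) e; by rewrite /sep e eqxx.
Qed.

Lemma sep_crossing (n : nat) (beta : nat -> W) g j : edge_path S n beta -> (j <= n)%N ->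
  root g -> sep g (beta 0%N) (beta j) ->
  exists k (s : S), [/\ (k < j)%N, beta k.+1 = (beta k * val s)%g &
    act (beta k) (alpha s) = g \/ act (beta k) (alpha s) = - g].
Proof.
move=> bp; elim: j => [|j IH] jn rg; first by rewrite sepxx.
rewrite (sepD g _ (beta j)); have [h _|_ /= h] := boolP (sep g (beta 0%N) (beta j)).
  by have [k [s [kj ? ?]]] := IH (ltnW jn) rg h; exists k, s; split=> //; apply: leqW.
have [s sS e] := bp j jn; exists j, [` sS]%fset; split=> //.
by apply: sep_edge => //; rewrite -e.
Qed.

(** The wall in terms of roots, so that a sign change of [g] along a path exhibits an edge of it. *)
Definition root_wall (g : V) : set {fset W} :=
  [set e | exists x (s : S), e = [fset x; (x * val s)%g]%fset /\
     (act x (alpha s) = g \/ act x (alpha s) = - g)]%classic.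

Lemma fset2_eq (a b c d : W) : [fset a; b]%fset = [fset c; d]%fset ->
  (a = c /\ b = d) \/ (a = d /\ b = c).
Proof.
move=> e; have ha : a \in [fset c; d]%fset by rewrite -e !inE eqxx.
have hb : b \in [fset c; d]%fset by rewrite -e !inE eqxx orbT.
have hc : c \in [fset a; b]%fset by rewrite e !inE eqxx.
have hd : d \in [fset a; b]%fset by rewrite e !inE eqxx orbT.
move: ha hb hc hd; rewrite !inE.
by move=> /orP[]/eqP -> /orP[]/eqP -> /orP[]/eqP h1 /orP[]/eqP h2; (left + right).
Qed.

Lemma root_wall_is_wall g : root g -> is_wall S (root_wall g).
Proof.
move=> [x [s ->]]; exists (x * val s * x^-1)%g.
  by exists x, (val s); split=> //; apply: valP.
apply/seteqP; split=> e /=.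
  move=> [y [t [-> h]]]; exists y, (y * val t)%g.
  have -> : (x * val s * x^-1)%g = (y * val t * y^-1)%g.
    by apply: act_faithful => v; rewrite !act_refl; case: h => ->; rewrite ?rreflN.
  split=> //; first by exists (val t) => //; apply: valP.
    by rewrite mulgVK.
  by rewrite -!mulgA mulKg gensq mulg1.
move=> [y [z [[t tS ->] -> h _]]]; exists y, [` tS]%fset; split=> //.
have ry : root (act y (alpha [` tS]%fset)) by apply/root_act/root_alpha.
have rx : root (act x (alpha s)) by apply/root_act/root_alpha.
have exy : (x * val s * x^-1)%g = (y * val [` tS]%fset * y^-1)%g by rewrite /= -h mulgK.
(* Evaluating the common reflection at the root [u] of the edge gives [- u] on one side and [u]
   minus a multiple of [v] on the other, so [u] is proportional to [v]. *)
have := act_refl y [` tS]%fset (act y (alpha [` tS]%fset)); rewrite -exy act_refl.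
set u := act y _ in ry *; set v := act x _ in rx *.
rewrite /rrefl (B_root ry) mulr1 scaler_nat mulr2n => /(congr1 (fun w => u - w)).
rewrite !opprD !opprK !addNKr => h'.
apply: (root_scale (c := B u v) rx ry); apply: coordP => q.
have := congr1 (coord^~ q) h'; rewrite !coordE; lra.
Qed.

Lemma root_wall_inj g h : root g -> pos g -> root h -> pos h ->
  root_wall g = root_wall h -> g = h.
Proof.
move=> rg pg rh ph; case: (rg) => x [s gE] e.
have : root_wall g [fset x; (x * val s)%g]%fset by exists x, s; split=> //; left.
rewrite e => -[y [t [/fset2_eq h2 yt]]].
have ygE : act y (alpha t) = g \/ act y (alpha t) = - g.
  case: h2 => [[xy]|[xy yx]].
    by rewrite -xy => /mulgI/val_inj <-; left.
  right; have ts : t = s.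
    by apply/val_inj/(mulgI (y)); rewrite -xy -yx genKr.
  by rewrite ts -yx actM act_gen_alpha actN gE.
have := root_pos rg; have := root_pos rh; rewrite pg ph => nh ng.
by case: ygE yt => -> [] e'; move: ng nh pg ph; rewrite -?e' ?opprK //;
  try (by move=> _ -> ); move/oppr_inj: e'.
Qed.

(** * Path metric and geodesics *)

Lemma joined_len x y n : joined S x y n -> (len (x^-1 * y)%g <= n)%N.
Proof.
case=> beta [bp <- <-]; elim: n bp => [|n IH] bp; first by rewrite mulVg len1.
have [s sS ->] := bp n (ltnSn n).
have := lenM ((beta 0%N)^-1 * beta n)%g (val [` sS]%fset).
rewrite mulgA len_gen addn1 => /leq_trans; apply; rewrite ltnS; apply: IH.
by move=> k kn; apply: bp; apply: ltnW.
Qed.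

Lemma geodesic_segment x y : exists beta : nat -> W,
  [/\ edge_path S (len (x^-1 * y)%g) beta, beta 0%N = x & beta (len (x^-1 * y)%g) = y].
Proof.
have [u uE us] := reduced_word (x^-1 * y)%g.
exists (fun k => x * wprod (take k u))%g; split.
- move=> k; rewrite -us => ku; have [t0 _] : exists t : S, t \in u.
    by case: (u) ku => // t u' _; exists t; rewrite mem_head.
  exists (val (nth t0 u k)); first exact: valP.
  by rewrite (take_nth t0 ku) -cats1 wprod_cat /= mulg1 mulgA.
- by rewrite take0 mulg1.
- by rewrite -us take_size uE mulVKg.
Qed.

Lemma distE x y : dist S x y = len (x^-1 * y)%g.
Proof.
have jl : joined S x y (len (x^-1 * y)%g) by apply: geodesic_segment.
rewrite /dist; case: pselect => [ex|[]]; last by exists (len (x^-1 * y)%g); apply/asboolP.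
case: ex_minnP => k /asboolP/joined_len kge kmin; apply/eqP.
by rewrite eqn_leq kge andbT; apply: kmin; apply/asboolP.
Qed.

Lemma len_path n (beta : nat -> W) i j : edge_path S n beta -> (i <= j)%N -> (j <= n)%N ->
  (len ((beta i)^-1 * beta j)%g <= j - i)%N.
Proof.
move=> bp ij jn; apply: joined_len; exists (fun k => beta (i + k)%N).
split; rewrite ?addn0 ?subnKC // => k kji; rewrite addnS; apply: bp.
by move: kji ij jn; clear; lia.
Qed.

Lemma edge_path_geodesic n (beta : nat -> W) : edge_path S n beta ->
  n = len ((beta 0%N)^-1 * beta n)%g -> geodesic S n beta.
Proof.
move=> bp nE; have main s t : (s <= t)%N -> (t <= n)%N ->
    dist S (beta s) (beta t) = (t - s)%N.
  move=> st tn; rewrite distE.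
  have := len_path bp (leq0n s) (leq_trans st tn); have := len_path bp st tn.
  have := len_path bp tn (leqnn n).
  have := len_triangle (beta 0%N) (beta s) (beta n); rewrite -nE.
  have := len_triangle (beta s) (beta t) (beta n).
  move: (len _) (len _) (len _) (len _) st tn; clear; lia.
move=> s t sn tn; have [st|/ltnW ts] := leqP s t.
  by rewrite main // -subzn // distrC ger0_norm // subr_ge0 lez_nat.
have -> : dist S (beta s) (beta t) = dist S (beta t) (beta s) by rewrite !distE dC.
by rewrite main // -subzn // ger0_norm // subr_ge0 lez_nat.
Qed.

Lemma geodesic_through n (p : nat -> W) :
  (forall i j k, (i <= j)%N -> (j <= k)%N -> (k <= n)%N -> between (p i) (p j) (p k)) ->
  exists l beta, [/\ edge_path S l beta, geodesic S l beta, beta 0%N = p 0%N, beta l = p n &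
    forall j, (j <= n)%N -> exists2 k, (k <= l)%N & beta k = p j].
Proof.
move=> btw; suff [beta [bp b0 bn bj]] : exists beta,
    [/\ edge_path S (len ((p 0%N)^-1 * p n)%g) beta, beta 0%N = p 0%N,
        beta (len ((p 0%N)^-1 * p n)%g) = p n &
        forall j, (j <= n)%N -> exists2 k, (k <= len ((p 0%N)^-1 * p n)%g)%N & beta k = p j].
  exists (len ((p 0%N)^-1 * p n)%g), beta; split=> //.
  by apply: edge_path_geodesic => //; rewrite b0 bn.
elim: n btw => [|n IH] btw.
  exists (fun=> p 0%N); rewrite mulVg len1; split=> // j; rewrite leqn0 => /eqP ->.
  by exists 0%N.
case: IH => [i j k ij jk kn|beta [bp b0 bn bj]]; first by apply: btw => //; apply: leqW.
have := btw 0%N n n.+1 isT (leqnSn n) (leqnn _); rewrite /between => ->.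
have [gam [gp g0 gn]] := geodesic_segment (p n) (p n.+1).
set L := len _ in bp bn bj *; set M := len _ in gp gn *.
exists (fun k => if (k <= L)%N then beta k else gam (k - L)%N); split=> //.
- move=> k kLM; case: (ltngtP k L) => kL.
  + exact: bp.
  + have -> : (k.+1 - L = (k - L).+1)%N by rewrite subSn // ltnW.
    by apply: gp; rewrite ltn_subLR // ltnW.
  + have -> : (k.+1 - L = 1)%N by rewrite kL subSnn.
    rewrite kL bn -g0; apply: gp.
    by move: kLM; rewrite kL -[X in (X < _)%N]addn0 ltn_add2l.
- case: leqP => h; last by rewrite addKn.
  have M0 : M = 0%N by move: h; clear; lia.
  by move: gn; rewrite M0 addn0 bn g0.
- move=> j; rewrite leq_eqVlt ltnS => /orP[/eqP ->|/bj[k kL <-]].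
    exists (L + M)%N => //; case: leqP => h; last by rewrite addKn.
    have M0 : M = 0%N by move: h; clear; lia.
    by move: gn; rewrite M0 addn0 bn g0.
  by exists k; rewrite ?kL // (leq_trans kL) ?leq_addr.
Qed.

(** * The tracking points *)

Lemma bracketing_walls_finite n eta k : finite_set (bracketing_walls S n eta k).
Proof.
apply: (@sub_finite_set _ _ [set wall S (eta i.+1 * (eta i)^-1)%g | i in `I_n]%classic).
  move=> Q [[r _ ->] [i [j [ik kj jn [x [y [_ e rx ry]]] _]]]].
  exists i => /=; first exact: leq_trans ik (leq_trans kj (ltnW jn)).
  congr wall; case: (fset2_eq e) => -[-> ->].
    by rewrite -rx mulgK.
  by rewrite -ry mulgK.
exact/finite_image/finite_II.
Qed.

(* The points [p j] lie on one geodesic from [eta i] back to [eta 0]; [X] is the set of walls that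
   moved [p j] away from [eta j]. *)
Definition tracking_state (C : nat) (eta : nat -> W) (i : nat) (p : nat -> W) : Prop :=
  [/\ p 0%N = eta 0%N /\ p i = eta i,
      forall l j k, (l <= j)%N -> (j <= k)%N -> (k <= i)%N -> between (p l) (p j) (p k),
      forall j g, (j <= i)%N -> root g ->
        sep g (eta 0%N) (p j) -> sep g (eta 0%N) (eta j) &
      forall j, (j <= i)%N -> exists X : {fset V},
        (len ((eta j)^-1 * p j)%g <= C * #|` X|)%N /\
        forall g, g \in X ->
          [/\ root g /\ pos g, sep g (eta 0%N) (eta j), ~~ sep g (eta 0%N) (p j) &
            exists k (s : S), [/\ (j <= k)%N, (k < i)%N, eta k.+1 = (eta k * val s)%g &
              act (eta k) (alpha s) = g \/ act (eta k) (alpha s) = - g]]].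

Lemma sep_generator_side g t0 (s : S) x : root g ->
  act t0 (alpha s) = g \/ act t0 (alpha s) = - g ->
  sep g t0 x = wle (val s) (t0^-1 * x)%g.
Proof. by move=> rg; rewrite -sep_gen => -[->|->]; rewrite ?sepN. Qed.

Lemma tracking_up C eta i p (s : S) : eta i.+1 = (eta i * val s)%g ->
  ~~ wle (val s) ((eta i)^-1 * eta 0%N)%g -> tracking_state C eta i p ->
  tracking_state C eta i.+1 (fun j => if (j <= i)%N then p j else eta i.+1).
Proof.
move=> es up [[p0 pi] btw mono dis]; split.
- by rewrite leq0n ltnn.
- have d1 : len ((eta 0%N)^-1 * eta i.+1)%g = (len ((eta 0%N)^-1 * eta i)%g).+1.
    have e : ((eta i * val s)^-1 * eta 0%N)%g = (val s * ((eta i)^-1 * eta 0%N))%g.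
      by rewrite invgM genV mulgA.
    rewrite es (dC (eta 0%N)) e (dC (eta 0%N)); move: up; rewrite wle_gen.
    by case: (len_mull s ((eta i)^-1 * eta 0%N)%g) => // ->; rewrite ltnSn.
  move=> l j k lj jk; rewrite leq_eqVlt ltnS => /orP[/eqP ki|ki]; last first.
    by rewrite ki (leq_trans jk ki) (leq_trans lj (leq_trans jk ki)); apply: btw.
  rewrite ki ltnn; have [ji|ji] := leqP j i; last first.
    exact: between_right.
  rewrite (leq_trans lj ji); have := btw 0%N l i isT (leq_trans lj ji) (leqnn i).
  have := btw l j i lj ji (leqnn i); rewrite /between p0 pi.
  have := len_triangle (eta 0%N) (p l) (eta i.+1).
  have := len_triangle (p l) (p j) (eta i.+1).
  have := len_triangle (p j) (eta i) (eta i.+1).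
  have -> : len ((eta i)^-1 * eta i.+1)%g = 1%N by rewrite es mulKg len_gen.
  rewrite d1; move: (len _) (len _) (len _) (len _) (len _) (len _) (len _).
  by clear; lia.
- move=> j g ji rg; case: leqP => h; first exact: mono.
  by have -> : j = i.+1 by move: ji h; clear; lia.
- move=> j ji; case: leqP => h.
    have [X [Xl XP]] := dis j h; exists X; split=> // g /XP[rg sg ng [k [t [jk ki ? ?]]]].
    by split=> //; exists k, t; split=> //; apply: ltnW.
  have -> : j = i.+1 by move: ji h; clear; lia.
  by exists fset0; rewrite mulVg len1.
Qed.
(** Seen from [t], the points form a descending chain [q] from [b] to 1. Joining with [val s]
    preserves the order, fixes [b] and turns 1 into [val s], so the new points again lie on one
    geodesic, now from [eta 0] to [eta i.+1]. *)
Lemma tracking_down C eta i p (s : S) :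
  (forall t q b x, is_join t q b x -> (len (q^-1 * x)%g <= C)%N) ->
  eta i.+1 = (eta i * val s)%g -> wle (val s) ((eta i)^-1 * eta 0%N)%g ->
  tracking_state C eta i p -> exists p', tracking_state C eta i.+1 p'.
Proof.
move=> CP es down [[p0 pi] btw mono dis].
set t := eta i in es down pi; set b := (t^-1 * eta 0%N)%g in down.
pose q j := (t^-1 * p j)%g.
have qmono j k : (j <= k)%N -> (k <= i)%N -> wle (q k) (q j).
  by move=> jk ki; apply/betweenE; rewrite -pi; apply/betweenC/btw.
have q0 : q 0%N = b by rewrite /q p0.
have /boolp.choice[y yP] : forall j, exists x, (j <= i)%N -> is_join s (q j) b x.
  move=> j; have [ji|ji] := leqP j i; last by exists 1%g.
  have [|x xP] := @join_exists s (q j) b _ down; last by exists x.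
  by rewrite -q0; apply: qmono.
have ymono j k : (j <= k)%N -> (k <= i)%N -> wle (y k) (y j).
  move=> jk ki; have [_ _ _] := yP k ki; have [qy sy yb _] := yP j (leq_trans jk ki).
  by apply=> //; apply: wle_trans qy; apply: qmono.
have y0 : y 0%N = b.
  have [qy _ yb _] := yP 0%N isT; apply: wle_len_eq => //.
  by rewrite -q0; apply: wle_len.
have yi : y i = val s.
  have [_ sy _ ymin] := yP i (leqnn i); apply/esym/wle_len_eq => //.
  apply/wle_len/ymin => //; last exact: wle_refl.
  by rewrite /q pi mulVg wle1.
(* The new point lies between [p j] and [eta 0], so a move creates no new wall between [eta 0] and
   the point. *)
have far j g : (j <= i)%N -> root g -> sep g (eta 0%N) (t * y j)%g -> sep g (eta 0%N) (p j).
  move=> ji rg; have [qy _ yb _] := yP j ji => sg.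
  have btwj : between (p j) (t * y j)%g (eta 0%N).
    rewrite /between; have := wle_between qy yb.
    have -> : ((q j)^-1 * b = (p j)^-1 * eta 0%N)%g.
      by rewrite /q /b invgM -mulgA mulKg.
    have -> : ((q j)^-1 * y j = (p j)^-1 * (t * y j))%g by rewrite /q invgM invgK mulgA.
    by have -> : ((y j)^-1 * b = (t * y j)^-1 * eta 0%N)%g by rewrite /b invgM mulgA.
  have := sep_between rg (betweenC btwj) sg.
  by rewrite (sepD g (eta 0%N) (t * y j)%g) sg => ->.
(* The points with indices [i] and [i.+1] coincide: [y i = val s] places both at [eta i.+1]. *)
pose p' j := (t * y (minn j i))%g.
have p'E j : (j <= i)%N -> p' j = (t * y j)%g by move=> ji; rewrite /p' (minn_idPl ji).
have p'S : p' i.+1 = eta i.+1 by rewrite /p' (minn_idPr (leqnSn i)) yi.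
exists p'; split.
- by rewrite p'S p'E // y0 /b mulVKg.
- move=> l j k lj jk ki; rewrite /p' /between !invgM.
  have e u v : ((y u)^-1 * t^-1 * (t * y v) = (y u)^-1 * y v)%g.
    by rewrite -!mulgA mulKg.
  have m1 : wle (y (minn k i)) (y (minn j i)) by apply: ymono; lia.
  have m2 : wle (y (minn j i)) (y (minn l i)) by apply: ymono; lia.
  by rewrite !e dC (wle_between m1 m2) addnC dC [X in (_ + X)%N]dC.
- move=> j g; rewrite leq_eqVlt ltnS => /orP[/eqP ->|ji] rg; first by rewrite p'S.
  by rewrite p'E // => /far h; apply: mono => //; apply: h.
- move=> j; rewrite leq_eqVlt ltnS => /orP[/eqP ->|ji].
    by exists fset0; rewrite p'S mulVg len1.
  have [X [Xl XP]] := dis j ji; have jy := yP j ji; have [qy sy yb ymin] := jy.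
  have [sq|sq] := boolP (wle (val s) (q j)).
    have e : p' j = p j.
      rewrite p'E // -[p j](mulVKg t) -/(q j); congr (t * _)%g.
      apply: wle_len_eq; last exact: wle_len.
      by apply: ymin => //; [apply: wle_refl|apply: wle_trans yb].
    exists X; rewrite e; split=> // g /XP[rg sg ng [k [r [jk ki ? ?]]]].
    by split=> //; exists k, r; split=> //; apply: ltnW.
  have [g0 [rg0 pg0 tg0]] : exists g, [/\ root g, pos g &
      act t (alpha s) = g \/ act t (alpha s) = - g].
    have rt := root_act t (root_alpha s); have [h|h] := boolP (pos (act t (alpha s))).
      by exists (act t (alpha s)); split=> //; left.
    exists (- act t (alpha s)); rewrite root_pos // opprK.
    by split=> //; [apply: rootN|right].
  have side x : sep g0 t x = wle (val s) (t^-1 * x)%g by apply: sep_generator_side.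
  have g0a : sep g0 (eta 0%N) (p j).
    by rewrite (sepD g0 _ t) sepC !side -/(q j) (negbTE sq) -/b down.
  have g0p' : ~~ sep g0 (eta 0%N) (p' j).
    by rewrite p'E // (sepD g0 _ t) sepC !side mulKg sy -/b down.
  (* The wall of the step still separates [eta 0] from [p j], unlike all walls in [X]; so each move
     enlarges [X] by one. *)
  have g0X : g0 \notin X by apply/negP => /XP[_ _]; rewrite g0a.
  exists (g0 |` X)%fset; split.
    rewrite cardfsU1 g0X mulnS addnC; apply: leq_trans (len_triangle _ (p j) _) _.
    apply: leq_add => //; rewrite p'E //; have := CP _ _ _ _ jy.
    by rewrite /q invgM invgK mulgA.
  move=> g; rewrite in_fset1U => /orP[/eqP ->|/XP[[rg pg] sg ng [k [r [jk ki ? ?]]]]].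
    split=> //; first exact: mono.
    by exists i, s; split=> //; apply: ltnSn.
  split=> //; last by exists k, r; split=> //; apply: ltnW.
  by rewrite p'E //; apply: contra ng; apply: far.
Qed.

(** Each root in [X] separates [eta 0] from [eta j], which gives a crossing before [j], and its
    recorded step is a crossing at or after [j]. Distinct positive roots have distinct walls. *)
Lemma tracking_state_bracket C n eta p j : edge_path S n eta ->
  tracking_state C eta n p -> (j <= n)%N ->
  (len ((eta j)^-1 * p j)%g <= C * bracket_number S n eta)%N.
Proof.
move=> ep [_ _ _ dis] jn; have [X [Xl XP]] := dis j jn.
apply: leq_trans Xl _; rewrite leq_mul2l; apply/orP; right.
apply: (@leq_trans (bracket_number_at S n eta j)); last first.
  exact: (leq_bigmax (Ordinal (jn : (j < n.+1)%N))).
have <- : #|` [fset root_wall g | g in X]%fset| = #|` X|.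
  rewrite card_in_imfset // => g h /XP[[rg pg] _ _ _] /XP[[rh ph] _ _ _].
  exact: root_wall_inj.
apply: fsubset_leq_card; apply/fsubsetP => Q /imfsetP[g /= /XP[[rg pg] sg _ h] ->].
rewrite in_fset_set; last exact: bracketing_walls_finite.
rewrite inE /=; split; first exact: root_wall_is_wall.
have [i' [s' [i'j e' g']]] := sep_crossing ep jn rg sg.
case: h => k [s [jk kn e gk]]; exists i', k; split=> //.
  by exists (eta i'), s'; rewrite /path_edge e'.
by exists (eta k), s; rewrite /path_edge e.
Qed.

Lemma geodesic_tracking : exists C, forall n eta, edge_path S n eta ->
  exists l beta, [/\ edge_path S l beta, geodesic S l beta, beta 0%N = eta 0%N,
    beta l = eta n & tracked S (C * bracket_number S n eta) n eta l beta].
Proof.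
have [C CP] := join_bounded; exists C => n eta ep.
have st i : (i <= n)%N -> exists p, tracking_state C eta i p.
  elim: i => [|i IH] ni.
    exists (fun=> eta 0%N); split=> //.
    - by move=> l j k _ _ _; apply: between_right.
    - by move=> j g _ _; rewrite sepxx.
    - move=> j; rewrite leqn0 => /eqP ->; exists fset0.
      by rewrite mulVg len1.
  have [p tp] := IH (ltnW ni); have [s sS es] := ep i ni.
  have [dn|up] := boolP (wle (val [` sS]%fset) ((eta i)^-1 * eta 0%N)%g).
    exact: (@tracking_down C eta i p [` sS]%fset CP es dn tp).
  by exists (fun j => if (j <= i)%N then p j else eta i.+1); exact: (@tracking_up C eta i p [` sS]%fset es up tp).
have [p tp] := st n (leqnn n); have [[p0 pn] btw _ _] := tp.
have [l [beta [bp bg b0 bl bt]]] := geodesic_through btw.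
exists l, beta; split=> //; [by rewrite b0|by rewrite bl|].
move=> j jn; have [k kl kE] := bt j jn; exists k => //.
by rewrite distE kE; apply: tracking_state_bracket ep tp jn.
Qed.

End CoxeterSystem.

Theorem theorem5p5 (W : groupType) (S : {fset W}) (hWS : coxeter_system S)
    (R : realType) (lambda epsilon : R) (hlambda : 0 < lambda)
    (hepsilon : 0 <= epsilon) (B : nat) :
  exists K : nat,
    forall (a b : W) (n : nat) (alpha : nat -> W),
      (0 < n)%N -> edge_path S n alpha ->
      alpha 0%N = a -> alpha n = b ->
      quasi_geodesic lambda epsilon S n alpha ->
      bracket_number S n alpha = B ->
      exists (l : nat) (beta : nat -> W),
        [/\ edge_path S l beta, geodesic S l beta,
            beta 0%N = a, beta l = b &
            tracked S K n alpha l beta].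
Proof.
have [m [hm hp]] := hWS; have [C CP] := geodesic_tracking hm hp R.
exists (C * B)%N => a b n alpha n0 ap <- <- _ <-.
by have [l [beta [bp bg b0 bl bt]]] := CP n alpha ap; exists l, beta.
Qed.
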